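(* Let $G=(\mathbf Z_2\wr\mathbf Z)^4$. Then Zero-divisors-in-$\mathbb Z[G]$ is undecidable: there is no algorithm which, given as input an element $T\in\mathbb Z[G]$, always halts and correctly decides whether $T$ is a zero-divisor in $\mathbb Z[G]$.
   Context: $\mathbf Z$ is the infinite cyclic group, $\mathbf Z_2$ the cyclic group of order $2$, and $\mathbf Z_2\wr\mathbf Z=\left(\bigoplus_{\mathbf Z}\mathbf Z_2\right)\rtimes\mathbf Z$, where $\mathbf Z$ acts by shifting coordinates; the exponent $4$ denotes the direct product of four copies. $\mathbb Z[G]$ is the integral group ring; its elements are given to the algorithm as finite formal integer combinations of words in a fixed finite generating set of $G$. An element $T$ is a zero-divisor if there is a nonzero $S\in\mathbb Z[G]$ with $TS=0$ or $ST=0$ (so $0$ counts as a zero-divisor). *)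

(* Defs.v *)
From HB Require Import structures.
From mathcomp Require Import all_boot all_algebra.
From mathcomp Require Import finmap.
From mathcomp.multinomials Require Import monalg.

Set Implicit Arguments.
Unset Strict Implicit.
Unset Printing Implicit Defensive.

Import GRing.Theory.
Local Open Scope fset_scope.
Local Open Scope ring_scope.

(* [{malg R[K]}] is the type of finitely supported functions from [K] to [R], *)
(* [g@_k] is the value of [g] at [k], and [<< r *g k >>] is the function with *)
(* value [r] at [k] and 0 elsewhere.                                          *)

Section Lamplighter.

Local Notation lamps := {malg 'Z_2[int]}.

Implicit Types (f : lamps) (n : int).

Definition shift n f : lamps := \sum_(k <- msupp f) << f@_k *g k + n >>.

Lemma shiftE n f k : (shift n f)@_k = f@_(k - n)%R.
Proof.
rewrite /shift raddf_sum /= [in RHS](monalgE f) raddf_sum /=.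
by apply: eq_bigr => i _; rewrite !mcoeffU eq_sym -subr_eq eq_sym.
Qed.

Lemma shiftD n : {morph shift n : f1 f2 / f1 + f2}.
Proof. by move=> f1 f2; apply/malgP => k; rewrite !(mcoeffD, shiftE). Qed.

Lemma shift_add n1 n2 f : shift n1 (shift n2 f) = shift (n1 + n2) f.
Proof. by apply/malgP => k; rewrite !shiftE opprD addrA. Qed.

Lemma shift0 f : shift 0 f = f.
Proof. by apply/malgP => k; rewrite shiftE subr0. Qed.

Lemma shiftn0 n : shift n 0 = 0.
Proof. by apply: (addrI (shift n 0)); rewrite -shiftD !addr0. Qed.

(* Z_2 wr Z = (\bigoplus_Z Z_2) ><| Z, with [n : int] acting by [shift n].     *)
Definition lamplighter := (lamps * int)%type.
HB.instance Definition _ := Choice.copy lamplighter (lamps * int)%type.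

Definition ll_one : lamplighter := (0, 0).
Definition ll_mul (x y : lamplighter) : lamplighter :=
  (x.1 + shift x.2 y.1, x.2 + y.2).
Definition ll_inv (x : lamplighter) : lamplighter :=
  (shift (- x.2) (- x.1), - x.2).

Fact ll_mulA : associative ll_mul.
Proof.
by move=> x y z; rewrite /ll_mul /= shiftD shift_add !addrA.
Qed.

Fact ll_mul1 : left_id ll_one ll_mul.
Proof. by case=> f n; rewrite /ll_mul /= shift0 !add0r. Qed.

Fact ll_mulr1 : right_id ll_one ll_mul.
Proof. by case=> f n; rewrite /ll_mul /= shiftn0 !addr0. Qed.

Fact ll_mulV : left_inverse ll_one ll_inv ll_mul.
Proof.
by case=> f n; rewrite /ll_mul /= -shiftD !addNr shiftn0.
Qed.

Fact ll_mulrV : right_inverse ll_one ll_inv ll_mul.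
Proof.
by case=> f n; rewrite /ll_mul /= shift_add subrr shift0 subrr.
Qed.

HB.instance Definition _ := isGroup.Build lamplighter
  ll_mulA ll_mul1 ll_mulr1 ll_mulV ll_mulrV.

End Lamplighter.

(* [monalg] makes [{malg R[K]}] a ring only for monoids [K] without           *)
(* nontrivial units, hence the separate construction for groups.              *)
Section GroupRing.
Variables (R : nzRingType) (G : groupType).

Definition groupring := {malg R[G]}.
HB.instance Definition _ := GRing.Zmodule.copy groupring {malg R[G]}.

Implicit Types g : groupring.

Definition gr_one : groupring := << 1 *g 1%g >>.
Definition gr_mul g1 g2 : groupring :=
  \sum_(x <- msupp g1) \sum_(y <- msupp g2) << g1@_x * g2@_y *g (x * y)%g >>.

Lemma gr_mulw (d1 d2 : {fset G}) g1 g2 :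
  msupp g1 `<=` d1 -> msupp g2 `<=` d2 ->
  gr_mul g1 g2 =
    \sum_(x <- d1) \sum_(y <- d2) << g1@_x * g2@_y *g (x * y)%g >>.
Proof.
move=> le1 le2; rewrite /gr_mul (big_fset_incl _ le1) /=.
  apply: eq_bigr => x _; apply: big_fset_incl => // y _ /mcoeff_outdom ->.
  by rewrite mulr0 monalgU0.
move=> x _ /mcoeff_outdom g1x.
by rewrite big1 // => y _; rewrite g1x mul0r monalgU0.
Qed.

Lemma gr_mulUU c1 c2 x y :
  gr_mul << c1 *g x >> << c2 *g y >> = << c1 * c2 *g (x * y)%g >>.
Proof. by rewrite (gr_mulw msuppU_le msuppU_le) !big_seq_fset1 !mcoeffUU. Qed.

Fact gr_mulDl : left_distributive gr_mul +%R.
Proof.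
move=> g1 g2 g.
rewrite [in RHS](gr_mulw (fsubsetUl _ (msupp g2)) (fsubset_refl _)).
rewrite [in RHS](gr_mulw (fsubsetUr (msupp g1) _) (fsubset_refl _)).
rewrite (gr_mulw (msuppD_le _ _) (fsubset_refl _)).
rewrite -big_split /=; apply: eq_bigr => x _.
rewrite -big_split /=; apply: eq_bigr => y _.
by rewrite mcoeffD mulrDl monalgUD.
Qed.

Fact gr_mulDr : right_distributive gr_mul +%R.
Proof.
move=> g g1 g2.
rewrite [in RHS](gr_mulw (fsubset_refl _) (fsubsetUl _ (msupp g2))).
rewrite [in RHS](gr_mulw (fsubset_refl _) (fsubsetUr (msupp g1) _)).
rewrite (gr_mulw (fsubset_refl _) (msuppD_le _ _)).
rewrite -big_split /=; apply: eq_bigr => x _.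
rewrite -big_split /=; apply: eq_bigr => y _.
by rewrite mcoeffD mulrDr monalgUD.
Qed.

Lemma gr_mul0 : left_zero 0 gr_mul.
Proof. by move=> g; rewrite /gr_mul msupp0 big_seq_fset0. Qed.

Lemma gr_mulr0 : right_zero 0 gr_mul.
Proof.
by move=> g; rewrite /gr_mul msupp0 big1 // => x _; rewrite big_seq_fset0.
Qed.

Lemma gr_mul_suml I (s : seq I) (F : I -> groupring) g :
  gr_mul (\sum_(i <- s) F i) g = \sum_(i <- s) gr_mul (F i) g.
Proof.
exact: (big_morph (gr_mul^~ g) (fun _ _ => gr_mulDl _ _ _) (gr_mul0 g)).
Qed.

Lemma gr_mul_sumr I (s : seq I) (F : I -> groupring) g :
  gr_mul g (\sum_(i <- s) F i) = \sum_(i <- s) gr_mul g (F i).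
Proof.
exact: (big_morph (gr_mul g) (fun _ _ => gr_mulDr _ _ _) (gr_mulr0 g)).
Qed.

Fact gr_mulA : associative gr_mul.
Proof.
move=> g1 g2 g3; rewrite [g1]monalgE [LHS]gr_mul_suml.
rewrite [X in _ = gr_mul X _]gr_mul_suml [RHS]gr_mul_suml.
apply: eq_bigr => x _; rewrite [g2]monalgE.
rewrite [X in gr_mul _ X = _]gr_mul_suml [LHS]gr_mul_sumr.
rewrite [X in _ = gr_mul X _]gr_mul_sumr [RHS]gr_mul_suml.
apply: eq_bigr => y _; rewrite [g3]monalgE.
rewrite [X in gr_mul _ X = _]gr_mul_sumr [LHS]gr_mul_sumr [RHS]gr_mul_sumr.
by apply: eq_bigr => z _; rewrite !gr_mulUU mulrA mulgA.
Qed.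

Fact gr_mul1 : left_id gr_one gr_mul.
Proof.
move=> g; rewrite [g]monalgE [LHS]gr_mul_sumr; apply: eq_bigr => x _.
by rewrite gr_mulUU mul1r mul1g.
Qed.

Fact gr_mulr1 : right_id gr_one gr_mul.
Proof.
move=> g; rewrite [g]monalgE [LHS]gr_mul_suml; apply: eq_bigr => x _.
by rewrite gr_mulUU mulr1 mulg1.
Qed.

Fact gr_one_neq0 : gr_one != 0.
Proof. by rewrite monalgU_eq0 oner_eq0. Qed.

HB.instance Definition _ := GRing.Zmodule_isNzRing.Build groupring
  gr_mulA gr_mul1 gr_mulr1 gr_mulDl gr_mulDr gr_one_neq0.

End GroupRing.

Definition zero_divisor (R : nzRingType) (T : R) : Prop :=
  exists2 S : R, S != 0 & T * S = 0 \/ S * T = 0.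

(* A letter [(i, b)] stands for the [i]-th generator, inverted if [b] holds;  *)
(* the term [(z, w)] of a formal combination stands for [z] times [w].        *)
Definition word n := seq ('I_n * bool).
Definition formal_sum n := seq (int * word n).

Section Evaluation.
Variables (G : groupType) (n : nat) (gen : 'I_n -> G).

Definition word_value (w : word n) : G :=
  (\prod_(l <- w) if l.2 then (gen l.1)^-1 else gen l.1)%g.

Definition sum_value (s : formal_sum n) : groupring int G :=
  \sum_(t <- s) << t.1 *g word_value t.2 >>.

Definition generates := forall x : G, exists w : word n, word_value w = x.

End Evaluation.

(* The hypothesis [generates gen] is satisfiable for (Z_2 wr Z)^4. *)
Section FiniteGeneration.

Section Generated.
Variables (G : groupType) (n : nat) (gen : 'I_n -> G).

Definition generated (x : G) := exists w : word n, word_value gen w = x.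

Lemma generated1 : generated 1%g.
Proof. by exists [::]; rewrite /word_value big_nil. Qed.

Lemma generatedM x y : generated x -> generated y -> generated (x * y)%g.
Proof. by move=> [u <-] [v <-]; exists (u ++ v); rewrite /word_value big_cat. Qed.

Lemma generated_gen i : generated (gen i).
Proof. by exists [:: (i, false)]; rewrite /word_value big_seq1. Qed.

Lemma generatedV x : generated x -> generated (x^-1)%g.
Proof.
case=> w <-; elim: w => [|[i b] w IHw].
  by rewrite /word_value big_nil invg1; apply: generated1.
rewrite /word_value big_cons invgM; apply: generatedM => //=.
case: b; first by rewrite invgK; apply: generated_gen.
by exists [:: (i, true)]; rewrite /word_value big_seq1.
Qed.

End Generated.

Local Notation L := lamplighter.

Let inj (i : 'I_4) (x : L) : {ffun 'I_4 -> L} :=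
  [ffun j => if j == i then x else 1%g].

Let injM i x y : inj i (x * y)%g = (inj i x * inj i y)%g.
Proof. by apply/ffunP => j; rewrite !ffunE; case: eqP => // _; rewrite mulg1. Qed.

Let injV i x : inj i (x^-1)%g = ((inj i x)^-1)%g.
Proof. by apply/ffunP => j; rewrite !ffunE; case: eqP => // _; rewrite invg1. Qed.

Let inj1 i : inj i 1%g = 1%g.
Proof. by apply/ffunP => j; rewrite !ffunE; case: eqP. Qed.

Let lamp : L := (<< (1 : 'Z_2) *g (0 : int) >>, 0).
Let step : L := (0, 1).

Let llM (x y : L) : (x * y)%g = (x.1 + shift x.2 y.1, x.2 + y.2) :> L.
Proof. by []. Qed.

Lemma lamplighter4_finitely_generated :
  exists (n : nat) (gen : 'I_n -> {ffun 'I_4 -> L}), generates gen.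
Proof.
exists #|{: 'I_4 * bool}|.
exists (fun j => let p := enum_val j in inj p.1 (if p.2 then lamp else step)).
set gen := fun _ => _.
have Hgen i (b : bool) : generated gen (inj i (if b then lamp else step)).
  by have := generated_gen gen (enum_rank (i, b)); rewrite /gen enum_rankK.
have Hstep i n : generated gen (inj i (0, n)).
  have Hpos m : generated gen (inj i (0, m%:Z)).
    elim: m => [|m IHm]; first by rewrite inj1; apply: generated1.
    have -> : (0, m.+1%:Z) = (step * ((0, m%:Z) : L))%g :> L.
      by rewrite llM /= shiftn0 addr0 intS.
    by rewrite injM; apply: generatedM => //; apply: (Hgen i false).
  case: n => m; first exact: Hpos.
  have -> : (0, Negz m) = (((0, m.+1%:Z) : L)^-1)%g :> L.
    by congr (_, _); rewrite /= oppr0 shiftn0.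
  by rewrite injV; apply: generatedV.
have Hlamps i f : generated gen (inj i (f, 0)).
  suff Hs (s : seq int) :
      generated gen (inj i (\sum_(k <- s) << f@_k *g k >>, 0)).
    by rewrite (monalgE f); apply: Hs.
  elim: s => [|k s IHs]; first by rewrite big_nil inj1; apply: generated1.
  rewrite big_cons; set a := << _ *g _ >>; set S := \sum_(_ <- _) _.
  have -> : (a + S, 0) = (((a, 0) : L) * ((S, 0) : L))%g :> L.
    by rewrite llM /= shift0.
  rewrite injM; apply: generatedM; last exact: IHs.
  have : f@_k = 0 \/ f@_k = 1.
    by case: (f@_k) => [[|[|]]] // ?; [left|right]; apply: val_inj.
  rewrite /a; case=> ->; first by rewrite monalgU0 inj1; apply: generated1.
  have -> : (<< 1 *g k >>, 0) = (((0, k) : L) * lamp * ((0, - k) : L))%g :> L.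
    rewrite !llM /= shiftn0 addr0 add0r addr0 subrr; congr (_, _).
    apply/malgP => j; rewrite shiftE !mcoeffU eq_sym -subr_eq0.
    by rewrite -(subr_eq0 0) sub0r oppr_eq0.
  rewrite !injM; apply: generatedM => //; apply: generatedM => //.
  exact: (Hgen i true).
have Hinj i x : generated gen (inj i x).
  have -> : x = (((x.1, 0) : L) * ((0, x.2) : L))%g.
    by rewrite llM /= shiftn0 addr0 add0r; case: x.
  by rewrite injM; apply: generatedM.
move=> x; change (generated gen x).
have -> : x = (\prod_(i < 4) inj i (x i))%g.
  apply/ffunP => j; rewrite !big_ord_recl big_ord0 !ffunE.
  case: (split_ordP (m := 1) (n := 3) j) => k ->.
    by case: k => [[|]] //= ?; rewrite ?mulg1 ?mul1g; congr (x _); apply: val_inj.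
  case: k => [[|[|[|]]]] //= ?;
    by rewrite ?mulg1 ?mul1g; congr (x _); apply: val_inj.
by apply: big_ind => //; [apply: generated1 | move=> *; apply: generatedM].
Qed.

End FiniteGeneration.

(* Goedel numbering of the inputs, over the bijection                         *)
(* [CodeSeq.code : seq nat -> nat].                                           *)
Definition code_letter n (l : 'I_n * bool) : nat := (l.1.*2 + l.2)%N.
Definition code_word n (w : word n) : nat :=
  CodeSeq.code [seq code_letter l | l <- w].
Definition code_int (z : int) : nat :=
  match z with Posz m => m.*2 | Negz m => m.*2.+1 end.
Definition code_sum n (s : formal_sum n) : nat :=
  CodeSeq.code [seq CodeSeq.code [:: code_int t.1; code_word t.2] | t <- s].

(* Algorithms are Kleene's partial recursive functions: [murec k] is the type *)
(* of programs for [k]-ary ones, [mueval c v y] means that [c] halts on [v]   *)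
(* with output [y].                                                           *)
Inductive murec : nat -> Type :=
| MuZero : murec 0
| MuSucc : murec 1
| MuProj k : 'I_k -> murec k
| MuComp k m : murec m -> ('I_m -> murec k) -> murec k
| MuRec k : murec k -> murec k.+2 -> murec k.+1
| MuMin k : murec k.+1 -> murec k.

Fixpoint primrec_graph (base : nat -> Prop) (step : nat -> nat -> nat -> Prop)
    (m : nat) : nat -> Prop :=
  if m is m'.+1
  then fun y => exists2 z, primrec_graph base step m' z & step m' z y
  else base.

Fixpoint mueval k (c : murec k) : k.-tuple nat -> nat -> Prop :=
  match c in murec k return k.-tuple nat -> nat -> Prop with
  | MuZero => fun _ y => y = 0%N
  | MuSucc => fun v y => y = (thead v).+1
  | MuProj k i => fun v y => y = tnth v i
  | MuComp k m f h => fun v y =>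
      exists2 u : m.-tuple nat,
        forall i, mueval (h i) v (tnth u i) & mueval f u y
  | MuRec k f h => fun v =>
      let a := [tuple of behead v] in
      primrec_graph (mueval f a)
        (fun m z y => mueval h [tuple of m :: z :: a] y) (thead v)
  | MuMin k f => fun v y =>
      mueval f [tuple of y :: v] 0%N /\
      forall i, (i < y)%N -> exists z, mueval f [tuple of i :: v] z.+1
  end.

(* The program is only required to behave on codes of elements of [X].        *)
Definition algorithmically_decidable X (code : X -> nat) (P : X -> Prop) :=
  exists c : murec 1, forall x : X, exists b : bool,
    mueval c [tuple code x] b /\ (b <-> P x).

(* Main.v *)
Require Import Defs.
From HB Require Import structures.
From mathcomp Require Import all_boot all_algebra.
From mathcomp Require Import finmap.
From mathcomp.multinomials Require Import monalg.
From mathcomp Require Import zify ring.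

(** The proof turns the question whether [T] is a zero divisor into the halting
    problem of a two-counter machine, and then runs a diagonal argument on a
    machine that would contain the supposed decision procedure.

    Sums of squares. For [T] the sum of [star u * u] over a finite list of
    elements [u], the coefficient of [star S * (T * S)] at the identity is the
    sum of the squares of all coefficients of all [u * S]. Hence [T * S = 0]
    iff every [u * S] vanishes, and as [T] is self-adjoint left and right zero
    divisors agree: [T] is a zero divisor iff the elements [u] have a common
    nonzero right annihilator ([zero_divisor_sum_squares]).

    Fourier transform. A character of the direct sum of four copies of the
    lamps is a quadruple [y] of two-sided infinite binary tapes. Decomposing
    along these characters turns [S] into a family of finitely supported
    integer functions, one for each [y], on the positions [h] in [Z^4] of four
    independent read heads. Multiplying by a lamp multiplies the function by
    the sign read in one cell near the head, and multiplying by a translation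
    moves the heads ([fourier_lamp], [fourier_translation]). The transform is
    injective ([fourier_neq0]), so an equation [u * S = 0] can express any law
    of the form: where the tapes near the heads look so and so, the function
    vanishes, or takes the same value after a given move ([enforces_law_elt]).
    Conversely the indicator of a finite set of positions on one tape lifts to
    an element of the group ring ([exists_annihilated]).

    Certificates. A head position encodes a configuration of a two-counter
    machine: the first two heads stand as far to the right of a mark as the
    counters say, and the third one stands on the current entry of a
    certificate that lists the states and branches of a run. Every head
    position has at most one certified predecessor and one certified successor.
    The laws say that the function is constant along certified moves and
    vanishes where the certificate is locally wrong. A nonzero solution of
    finite support can then be followed back to a start mark and from there
    forward along the actual run, which has to end ([certificate_sound]); a
    halting run yields a solution ([certificate_complete]). Only the elements
    [input_elts e], each of which reads two cells, depend on the input [e]: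
    they set the first counter at a start ([zero_divisor_accepts]).

    Diagonal. Partial recursive functions are compiled to structured programs
    on registers, which are exponents of primes in a single number, and these
    to two-counter machines. It is enough that the compiled machine follows
    every terminating computation ([cmd_of_correct], [compile_correct]),
    because the machine is deterministic. Given a decision procedure, let [P]
    be the machine that on input [2 ^ x] runs it on the formal sum made of the
    terms for the input [2 ^ x] followed by the formal sum of code [x], and
    halts iff the answer is no. Prepending terms to a coded list is primitive
    recursive ([computable_reduction]). Taking for [x] the code of a formal sum
    for the elements of [P] itself, the machine halts iff the procedure denies
    that it halts. *)

Set Implicit Arguments.
Unset Strict Implicit.
Unset Printing Implicit Defensive.

Import GRing.Theory Num.Theory.

(** * Two-counter machines *)

(** [IncBy c k q] adds [k] to counter [c] and goes to state [q]; [DecBy c k q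
    q'] subtracts [k] and goes to [q] if the counter is at least [k], and
    otherwise goes to [q'] without changing it. Steps of arbitrary length cost
    nothing on the tapes and make multiplication a two-state loop. States are
    addresses, and the address past the end is the accepting one. *)
Inductive instr :=
| IncBy of bool & nat & nat
| DecBy of bool & nat & nat & nat.

Definition program := seq instr.
Definition config := (nat * (nat * nat))%type.

Definition counter (v : nat * nat) (c : bool) := if c then v.2 else v.1.
Definition set_counter (v : nat * nat) (c : bool) x :=
  if c then (v.1, x) else (x, v.2).

Definition fetch (P : program) q := nth (IncBy false 0 0) P q.

(** Configurations outside the program are fixed, so that accepting is a stable
    condition. *)
Definition step (P : program) (s : config) : config :=
  let: (q, v) := s in
  if q < size P then
    match fetch P q with
    | IncBy c k q' => (q', set_counter v c (counter v c + k))
    | DecBy c k q1 q2 =>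
        if k <= counter v c then (q1, set_counter v c (counter v c - k))
        else (q2, v)
    end
  else s.

Definition run P e n : config := iter n (step P) (0, (e, 0)).

Definition accepts P e := exists n, (run P e n).1 = size P.

(** * Structured programs and their compilation *)

(** Programs acting on one number: [While p c] repeats [c] as long as [p]
    divides the number. *)
Inductive cmd :=
| Skip
| Mul of nat
| Div of nat
| Seq of cmd & cmd
| While of nat & cmd.

(** [Div p] has a rule for multiples of [p] only; the compiler relies on this.
    *)
Inductive exec : cmd -> nat -> nat -> Prop :=
| ExecSkip N : exec Skip N N
| ExecMul p N : exec (Mul p) N (N * p)
| ExecDiv p N : exec (Div p) (N * p) N
| ExecSeq c1 c2 N N1 N2 : exec c1 N N1 -> exec c2 N1 N2 ->
    exec (Seq c1 c2) N N2
| ExecStop p c N : ~~ (p %| N) -> exec (While p c) N N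
| ExecLoop p c N N1 N2 : p %| N -> exec c N N1 -> exec (While p c) N1 N2 ->
    exec (While p c) N N2.

Fixpoint bases_gt0 c :=
  match c with
  | Skip => true
  | Mul p | Div p => 0 < p
  | Seq c1 c2 => bases_gt0 c1 && bases_gt0 c2
  | While p c => (0 < p) && bases_gt0 c
  end.

Fixpoint code_size c :=
  match c with
  | Skip => 0
  | Mul _ | Div _ => 4
  | Seq c1 c2 => code_size c1 + code_size c2
  | While _ c => code_size c + 9
  end.

(** Between commands the second counter is zero; a loop that moves the number
    into the second counter is followed by this one, which moves it back. *)
Definition restore b exit := [:: DecBy true 1 b.+1 exit; IncBy false 1 b].

(** The entry of a loop moves the number into the second counter in steps of
    [p]. What is left in the first counter is the remainder: state [b + 2]
    tests it, [b + 4] restores a multiple of [p] and enters the body, while [b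
    + 3] and [b + 6] put the number together again and leave the loop. The last
    instruction adds zero: it is a jump. *)
Fixpoint compile c b : program :=
  match c with
  | Skip => [::]
  | Mul p =>
      [:: DecBy false 1 b.+1 b.+2; IncBy true p b] ++ restore b.+2 (b + 4)
  | Div p =>
      [:: DecBy false p b.+1 b.+2; IncBy true 1 b] ++ restore b.+2 (b + 4)
  | Seq c1 c2 => compile c1 b ++ compile c2 (b + code_size c1)
  | While p c =>
      [:: DecBy false p b.+1 b.+2; IncBy true p b;
          DecBy false 1 b.+3 (b + 4); IncBy false 1 (b + 6)]
      ++ restore (b + 4) (b + 8)
      ++ restore (b + 6) (b + code_size c + 9)
      ++ compile c (b + 8)
      ++ [:: IncBy false 0 b]
  end.

Lemma size_compile c b : size (compile c b) = code_size c.
Proof.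
elim: c b => //= [c1 IH1 c2 IH2|p c IH] b; rewrite size_cat ?IH1 ?IH2 //=.
by rewrite IH; lia.
Qed.

Definition reach P (s s' : config) := exists n, iter n (step P) s = s'.

Lemma reach_refl P s : reach P s s.
Proof. by exists 0. Qed.

Lemma reach_trans P s1 s2 s3 : reach P s1 s2 -> reach P s2 s3 -> reach P s1 s3.
Proof. by move=> [n <-] [n' <-]; exists (n' + n); rewrite iterD. Qed.

Definition instr_at P q i := q < size P /\ fetch P q = i.

Lemma reach_inc P q c k q' v : instr_at P q (IncBy c k q') ->
  reach P (q, v) (q', set_counter v c (counter v c + k)).
Proof. by move=> [lt_q E]; exists 1; rewrite /= lt_q E. Qed.

Lemma reach_dec P q c k q1 q2 v : instr_at P q (DecBy c k q1 q2) ->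
    k <= counter v c ->
  reach P (q, v) (q1, set_counter v c (counter v c - k)).
Proof. by move=> [lt_q E] le_k; exists 1; rewrite /= lt_q E le_k. Qed.

Lemma reach_dec_fail P q c k q1 q2 v : instr_at P q (DecBy c k q1 q2) ->
  counter v c < k -> reach P (q, v) (q2, v).
Proof. by move=> [lt_q E] lt_k; exists 1; rewrite /= lt_q E leqNgt lt_k. Qed.

Definition placed P b (code : program) :=
  forall i, i < size code -> instr_at P (b + i) (fetch code i).

Lemma placed_cat P b code1 code2 : placed P b (code1 ++ code2) ->
  placed P b code1 /\ placed P (b + size code1) code2.
Proof.
move=> H; split=> i lt_i.
  have := H i; rewrite size_cat /fetch nth_cat lt_i; apply.
  by rewrite ltn_addr.
have := H (size code1 + i).
rewrite size_cat /fetch nth_cat ltn_add2l lt_i addnA.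
by rewrite ifN -?leqNgt ?leq_addr // addKn; apply.
Qed.

Lemma reach_restore P b ex a x : placed P b (restore b ex) ->
  reach P (b, (a, x)) (ex, (a + x, 0)).
Proof.
move=> H; have := H 0 isT; have := H 1 isT; rewrite addn0 addn1 => H1 H0.
elim: x a => [|x IHx] a.
  by rewrite addn0; apply: (reach_dec_fail (v := (a, 0)) H0).
apply: reach_trans (reach_dec (v := (a, x.+1)) H0 isT) _.
apply: reach_trans (reach_inc _ H1) _ => /=.
by rewrite subn1 /= addn1 addnS -addSn; apply: IHx.
Qed.

(** One pass of the two-instruction loop that underlies multiplication,
    division and the divisibility test: it trades [p] units of the first
    counter for [k] units of the second. *)
Lemma reach_drain P b p k ex t r x : 0 < p ->
    instr_at P b (DecBy false p b.+1 ex) -> instr_at P b.+1 (IncBy true k b) ->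
  r < p -> reach P (b, (t * p + r, x)) (ex, (r, x + t * k)).
Proof.
move=> p0 H0 H1 lt_rp; elim: t x => [|t IHt] x.
  by rewrite mul0n addn0; apply: (reach_dec_fail (v := (r, x)) H0).
have le_p : p <= t.+1 * p + r by rewrite mulSn -addnA leq_addr.
apply: reach_trans (reach_dec (v := (_, x)) H0 le_p) _.
apply: reach_trans (reach_inc _ H1) _ => /=.
by rewrite !mulSn -addnA addKn addnA; apply: IHt.
Qed.

(** Separate from [compile_correct] because a loop that never ends has no
    [exec] derivation, yet [test_machine_accepts] needs its cycle. *)
Lemma compile_enter P b p c N : 0 < p -> p %| N ->
    placed P b (compile (While p c) b) ->
  [/\ reach P (b, (N, 0)) (b + 8, (N, 0)),
      placed P (b + 8) (compile c (b + 8)) &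
      instr_at P (b + 8 + code_size c) (IncBy false 0 b)].
Proof.
move=> p0 pN H.
have [H0 H1 H2] : [/\ instr_at P b (DecBy false p b.+1 b.+2),
    instr_at P b.+1 (IncBy true p b) &
    instr_at P b.+2 (DecBy false 1 b.+3 (b + 4))].
  by split; [have := H 0 isT|have := H 1 isT|have := H 2 isT];
    rewrite ?addn0 ?addn1 ?addn2.
have [_ {}H] := placed_cat (code1 := [:: _; _; _; _]) H.
have [Hr {}H] := placed_cat (code1 := restore (b + 4) _) H.
have [_ {}H] := placed_cat (code1 := restore (b + 6) _) H.
have [Hc Hj] := placed_cat H.
split.
- have E := reach_drain (N %/ p) 0 p0 H0 H1 p0.
  rewrite addn0 add0n divnK // in E; apply: reach_trans E _.
  apply: reach_trans (reach_dec_fail (v := (0, _)) H2 isT) _.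
  by have := reach_restore 0 N Hr; rewrite add0n.
- by rewrite -!addnA in Hc.
- have := Hj 0 isT.
  by rewrite size_compile /= (_ : _ + 0 = b + 8 + code_size c); last lia.
Qed.

(** Forward simulation suffices: the machine is deterministic, so the run it
    describes is the only one. *)
Lemma compile_correct c N N' : exec c N N' ->
  forall P b, bases_gt0 c -> placed P b (compile c b) ->
  reach P (b, (N, 0)) (b + code_size c, (N', 0)).
Proof.
elim=> {c N N'} [N|p N|p N|c1 c2 N N1 N2 _ IH1 _ IH2|p c N pN
  |p c N N1 N2 pN _ IH1 _ IH2] P b /=.
- by move=> _ _; rewrite addn0; apply: reach_refl.
- move=> p0 /(placed_cat (code1 := [:: _; _]))[H1 /=].
  rewrite addn2 => H2.
  have := H1 0 isT; have := H1 1 isT; rewrite addn0 addn1 => {H1} Hb1 Hb0.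
  have := reach_drain N 0 (ltn0Sn 0) Hb0 Hb1 (ltn0Sn 0).
  rewrite muln1 addn0 add0n => E; apply: reach_trans E _.
  by have := reach_restore 0 (N * p) H2; rewrite add0n.
- move=> p0 /(placed_cat (code1 := [:: _; _]))[H1 /=].
  rewrite addn2 => H2.
  have := H1 0 isT; have := H1 1 isT; rewrite addn0 addn1 => {H1} Hb1 Hb0.
  have := reach_drain N 0 p0 Hb0 Hb1 p0.
  rewrite muln1 addn0 add0n => E; apply: reach_trans E _.
  by have := reach_restore 0 N H2; rewrite add0n.
- move=> /andP[wf1 wf2] /placed_cat[]; rewrite size_compile => H1 H2.
  by rewrite addnA; apply: reach_trans (IH1 _ _ wf1 H1) (IH2 _ _ wf2 H2).
- move=> /andP[p0 _] H.
  have [H0 H1 H2 H3] : [/\ instr_at P b (DecBy false p b.+1 b.+2),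
      instr_at P b.+1 (IncBy true p b),
      instr_at P b.+2 (DecBy false 1 b.+3 (b + 4)) &
      instr_at P b.+3 (IncBy false 1 (b + 6))].
    by split; [have := H 0 isT|have := H 1 isT|have := H 2 isT|have := H 3 isT];
      rewrite ?addn0 ?addn1 ?addn2 ?addn3.
  have [_ {}H] := placed_cat (code1 := [:: _; _; _; _; _; _]) H.
  have {H} [Hr _] := placed_cat (code1 := restore (b + 6) _) H.
  have E := reach_drain (N %/ p) 0 p0 H0 H1 (ltn_pmod N p0).
  rewrite -divn_eq add0n in E; apply: reach_trans E _.
  have r0 : 0 < N %% p by rewrite lt0n.
  apply: reach_trans (reach_dec (v := (_, _)) H2 r0) _.
  apply: reach_trans (reach_inc _ H3) _ => /=; rewrite subnK //.
  have := reach_restore (N %% p) (N %/ p * p) Hr.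
  by rewrite [N %% p + _]addnC -divn_eq addnA.
move=> /[dup] wfw /andP[p0 wfc] /[dup] Hw /(compile_enter p0 pN)[E Hc Hj].
apply: reach_trans (reach_trans E (IH1 _ _ wfc Hc)) _.
apply: reach_trans (IH2 _ _ wfw Hw).
by have := reach_inc (N1, 0) Hj; rewrite /= addn0.
Qed.

Definition test_machine c p := compile (Seq c (While p Skip)) 0.

(** If [p] divides the result the machine returns to the entry of the final
    loop. Accepting configurations are fixed points of [step], so a machine
    with a cycle of at least one nontrivial step never accepts. *)
Lemma test_machine_accepts c p N N1 : exec c N N1 -> bases_gt0 c -> 0 < p ->
  accepts (test_machine c p) N <-> ~~ (p %| N1).
Proof.
move=> Ec wfc p0; set P := test_machine c p.
have HP : placed P 0 P by move=> i lt_i; rewrite add0n.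
have szP : size P = 0 + code_size (Seq c (While p Skip)).
  by rewrite size_compile.
split=> [[n acc]|pN1]; last first.
  have ex := ExecSeq Ec (ExecStop Skip pN1).
  have [|n En] := compile_correct ex _ HP; first by rewrite /= wfc p0.
  by exists n; rewrite /run En szP.
apply/negP => pN1.
have [Hc Hw] := placed_cat HP; rewrite size_compile in Hw.
have [t Et] := compile_correct Ec wfc Hc.
have [[a Ea] _ Hj] := compile_enter p0 pN1 Hw.
have [d Ed] := reach_inc (N1, 0) Hj.
rewrite /= !addn0 in Ed; rewrite !add0n in Et Ea Ed.
set s := (code_size c, (N1, 0)) in Et Ea Ed.
have ad0 : 0 < a + d.
  by case: a d Ea Ed => [|a] [|d] // [] /=; lia.
have loop k : iter (k * (d + a)) (step P) s = s.
  elim: k => // k IHk; rewrite mulSn iterD IHk iterD Ea; exact: Ed.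
have final i : run P N (i + n) = run P N n.
  elim: i => // i; rewrite addSn /run iterS -!/(run P N _) => ->.
  by move: acc; case: (run P N n) => q v /= ->; rewrite ltnn.
(* After [n] rounds of the cycle the run is past the accepting time. *)
have Es : s = run P N n.
  rewrite -(loop n) -Et -iterD -(final (n * (d + a) + t - n)) /run subnK //.
  by apply: leq_trans (leq_addr t _); rewrite leq_pmulr // addnC.
have : size P = s.1 by rewrite Es acc.
by rewrite szP /s /=; lia.
Qed.

(** * Registers as exponents of primes *)

Section Registers.
(** Registers are numbered, and register [r] is the exponent of the [r]-th term
    of a strictly increasing sequence of primes. *)
Fixpoint reg_prime r :=
  if r is r'.+1 then s2val (prime_above (reg_prime r')) else 2.

Arguments reg_prime : simpl never.

Lemma reg_prime_prime r : prime (reg_prime r).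
Proof. by case: r => // r; apply: (s2valP' (prime_above (reg_prime r))). Qed.

Lemma reg_prime_gt0 r : 0 < reg_prime r.
Proof. exact/prime_gt0/reg_prime_prime. Qed.

Lemma reg_prime_lt : {homo reg_prime : r s / r < s}.
Proof.
apply: homo_ltn; first exact: ltn_trans.
by move=> r; apply: (s2valP (prime_above (reg_prime r))).
Qed.

Lemma reg_prime_inj : injective reg_prime.
Proof. by apply: incn_inj => r s; apply: leq_mono reg_prime_lt r s. Qed.

Definition reg N r := logn (reg_prime r) N.

Lemma reg_mul N r x : 0 < N -> reg (N * reg_prime r) x = reg N x + (x == r).
Proof.
move=> N0; rewrite /reg lognM ?reg_prime_gt0 //.
by rewrite (logn_prime _ (reg_prime_prime r)) (inj_eq reg_prime_inj).
Qed.

Lemma reg_dvd N r : 0 < N -> (reg_prime r %| N) = (0 < reg N r).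
Proof. by move=> N0; rewrite logn_gt0 mem_primes reg_prime_prime N0. Qed.

Definition store := nat -> nat.
Implicit Types (s t u : store) (c : cmd).

Definition upd s r v : store := fun x => if x == r then v else s x.

Ltac upd_tac :=
  rewrite /upd; repeat match goal with
  | |- context [?a == ?b] => case: (a =P b) => ?
  end; subst; try lia; try congruence.

(** Existential in the final number, so that proofs deal with the contents of
    registers and never with the products of prime powers that represent them.
    *)
Definition does c s t := forall N, 0 < N -> reg N =1 s ->
  exists N', [/\ 0 < N', exec c N N' & reg N' =1 t].

Lemma does_eq c s t s' t' : does c s t -> s' =1 s -> t =1 t' -> does c s' t'.
Proof.
move=> H Es Et N N0 EN; have [x|N' [N'0 ex E']] := H N N0; first by rewrite EN.
by exists N'; split=> // x; rewrite E'.
Qed.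

Lemma does_eqr c s t t' : does c s t -> t =1 t' -> does c s t'.
Proof. by move=> H Et; apply: does_eq H _ Et. Qed.

Lemma does_skip s : does Skip s s.
Proof. by move=> N N0 E; exists N; split=> //; apply: ExecSkip. Qed.

Lemma does_seq c1 c2 s t u : does c1 s t -> does c2 t u -> does (Seq c1 c2) s u.
Proof.
move=> H1 H2 N N0 E; have [N1 [N10 ex1 E1]] := H1 N N0 E.
have [N2 [N20 ex2 E2]] := H2 N1 N10 E1; exists N2; split=> //.
exact: ExecSeq ex1 ex2.
Qed.

Definition Inc r := Mul (reg_prime r).
Definition Dec r := Div (reg_prime r).
Definition Loop r c := While (reg_prime r) c.

Lemma does_inc r s : does (Inc r) s (upd s r (s r).+1).
Proof.
move=> N N0 E; exists (N * reg_prime r); split.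
- by rewrite muln_gt0 N0 reg_prime_gt0.
- exact: ExecMul.
- by move=> x; rewrite reg_mul // E; upd_tac.
Qed.

Lemma does_dec r s : 0 < s r -> does (Dec r) s (upd s r (s r).-1).
Proof.
move=> sr N N0 E; have := reg_dvd r N0; rewrite E sr => /dvdnP[M EN].
have M0 : 0 < M by move: N0; rewrite EN muln_gt0 => /andP[].
exists M; split=> //; first by rewrite EN; apply: ExecDiv.
by move=> x; have := E x; have := E r; rewrite EN !reg_mul // eqxx; upd_tac.
Qed.

Lemma does_stop r c s : s r = 0 -> does (Loop r c) s s.
Proof.
move=> sr N N0 E; exists N; split=> //; apply: ExecStop.
by rewrite reg_dvd // E sr.
Qed.

Lemma does_loop r c s t u : 0 < s r -> does c s t -> does (Loop r c) t u ->
  does (Loop r c) s u.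
Proof.
move=> sr H1 H2 N N0 E; have [N1 [N10 ex1 E1]] := H1 N N0 E.
have [N2 [N20 ex2 E2]] := H2 N1 N10 E1; exists N2; split=> //.
by apply: ExecLoop ex1 ex2; rewrite reg_dvd // E.
Qed.

(** The loop rule in the form in which it is used: the store at each iteration
    is given explicitly, and so no invariant has to be guessed. *)
Lemma does_for r c n (st : nat -> store) :
    (forall i, i < n -> 0 < st i r /\ does c (st i) (st i.+1)) ->
    st n r = 0 ->
  does (Loop r c) (st 0) (st n).
Proof.
move=> body stop; suff H i : i <= n -> does (Loop r c) (st (n - i)) (st n).
  by have := H n (leqnn n); rewrite subnn.
elim: i => [|i IHi] le_in; first by rewrite subn0; apply: does_stop.
have lt_n : n - i.+1 < n by lia.
have [pos bd] := body _ lt_n; apply: does_loop pos bd _.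
rewrite (_ : (n - i.+1).+1 = n - i); last by lia.
exact: IHi (ltnW le_in).
Qed.

Definition clear r := Loop r (Dec r).

Lemma does_clear r s : does (clear r) s (upd s r 0).
Proof.
have H := @does_for r (Dec r) (s r) (fun i => upd s r (s r - i)).
apply: (does_eq (H _ _)) => [i lt_i||x|x]; try by upd_tac.
split; first by upd_tac.
by apply: does_eqr (@does_dec _ _ _) _ => [|x]; upd_tac.
Qed.

Definition transfer r d := Loop r (Seq (Dec r) (Inc d)).

Lemma does_transfer r d s : r <> d ->
  does (transfer r d) s (upd (upd s r 0) d (s d + s r)).
Proof.
move=> rd.
have H := @does_for r (Seq (Dec r) (Inc d)) (s r)
   (fun i => upd (upd s r (s r - i)) d (s d + i)).
apply: (does_eq (H _ _)) => [i lt_i||x|x]; try by upd_tac.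
split; first by upd_tac.
apply: does_seq; first by apply: does_dec; upd_tac.
by apply: does_eqr (@does_inc _ _) _ => x; upd_tac.
Qed.

(** A register can only be read destructively, so that its content goes to two
    registers and then comes back from one of them. *)
Definition duplicate r d tmp :=
  Seq (Loop r (Seq (Dec r) (Seq (Inc d) (Inc tmp)))) (transfer tmp r).

Lemma does_duplicate r d tmp s : r <> d -> r <> tmp -> d <> tmp -> s tmp = 0 ->
  does (duplicate r d tmp) s (upd s d (s d + s r)).
Proof.
move=> rd rt dt st0.
have H := @does_for r (Seq (Dec r) (Seq (Inc d) (Inc tmp))) (s r)
   (fun i => upd (upd (upd s r (s r - i)) d (s d + i)) tmp i).
apply: does_seq.
  apply: (does_eq (H _ _) _ (frefl _)) => [i lt_i||x]; try by upd_tac.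
  split; first by upd_tac.
  apply: does_seq; first by apply: does_dec; upd_tac.
  apply: does_seq; first exact: does_inc.
  by apply: does_eqr (@does_inc _ _) _ => x; upd_tac.
by apply: does_eqr (@does_transfer _ _ _ _) _ => [|x]; upd_tac.
Qed.

Lemma does_clears r n s :
  does (foldr (fun i => Seq (clear i)) Skip (iota r n)) s
    (fun x => if r <= x < r + n then 0 else s x).
Proof.
elim: n r s => [|n IHn] r s /=.
  by apply: does_eqr (@does_skip _) _ => x; case: ifP => //; lia.
apply: does_seq (@does_clear r s) _.
apply: does_eqr (IHn _ _) _ => x; rewrite /upd.
by case: (x =P r) => [->|]; case: ifP; case: ifP => //; lia.
Qed.

(** * Compiling partial recursive functions *)

Definition consr k r (ins : 'I_k -> nat) : 'I_k.+1 -> nat :=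
  fun i => if unlift ord0 i is Some j then ins j else r.

Definition tailr k (ins : 'I_k.+1 -> nat) : 'I_k -> nat :=
  fun i => ins (lift ord0 i).

(** The arguments are in the registers [ins], the value is added to register
    [out], and all registers from [fr] on are free and zero. Everything but
    [out] is left as it was; in particular the free registers are zero again,
    which lets commands be chained and repeated without bookkeeping. *)
Fixpoint cmd_of k (c : murec k) : ('I_k -> nat) -> nat -> nat -> cmd :=
  match c in murec k return ('I_k -> nat) -> nat -> nat -> cmd with
  | MuZero => fun ins out fr => Skip
  | MuSucc => fun ins out fr => Seq (duplicate (ins ord0) out fr) (Inc out)
  | MuProj k i => fun ins out fr => duplicate (ins i) out fr
  | MuComp k m f h => fun ins out fr =>
      Seq (foldr (fun i => Seq (cmd_of (h i) ins (fr + i) (fr + m))) Skip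
             (enum 'I_m))
     (Seq (cmd_of f (fun i => fr + i) out (fr + m))
          (foldr (fun r => Seq (clear r)) Skip (iota fr m)))
  | MuRec k f h => fun ins out fr =>
      let acc := fr in let idx := fr.+1 in let cnt := fr.+2 in
      let new := fr.+3 in let fr' := fr.+4 in
      Seq (cmd_of f (tailr ins) acc fr')
     (Seq (duplicate (ins ord0) cnt new)
     (Seq (Loop cnt
            (Seq (Dec cnt)
            (Seq (cmd_of h (consr idx (consr acc (tailr ins))) new fr')
            (Seq (clear acc)
            (Seq (transfer new acc) (Inc idx))))))
     (Seq (transfer acc out) (clear idx))))
  | MuMin k f => fun ins out fr =>
      let idx := fr in let val := fr.+1 in let fr' := fr.+2 in
      let test := cmd_of f (consr idx ins) val fr' in
      Seq test
     (Seq (Loop val (Seq (clear val) (Seq (Inc idx) test)))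
          (transfer idx out))
  end.

Lemma bases_gt0_cmd_of k (c : murec k) ins out fr :
  bases_gt0 (cmd_of c ins out fr).
Proof.
elim: c ins out fr => {k} /=; rewrite ?reg_prime_gt0 //=.
- by move=> ins out fr; rewrite !reg_prime_gt0.
- by move=> k i ins out fr; rewrite !reg_prime_gt0.
- move=> k m f IHf h IHh ins out fr; rewrite IHf /=; apply/andP; split.
    by elim: (enum _) => //= i s ->; rewrite IHh.
  by elim: (iota _ _) => //= i s ->; rewrite !reg_prime_gt0.
- by move=> k f IHf h IHh ins out fr; rewrite IHf IHh !reg_prime_gt0.
- by move=> k f IHf ins out fr; rewrite IHf !reg_prime_gt0.
Qed.

Lemma tnth_consr k (s : store) r (ins : 'I_k -> nat) x (v : k.-tuple nat) :
  s r = x -> (forall i, s (ins i) = tnth v i) ->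
  forall i, s (consr r ins i) = tnth [tuple of x :: v] i.
Proof.
move=> sr sv i; rewrite /consr; case: unliftP => [j|] ->; last by rewrite tnth0.
by rewrite tnthS sv.
Qed.

Lemma tnth_tailr k (s : store) (ins : 'I_k.+1 -> nat) (v : k.+1.-tuple nat) :
  (forall i, s (ins i) = tnth v i) ->
  forall i, s (tailr ins i) = tnth [tuple of behead v] i.
Proof.
move=> sv i; rewrite /tailr sv tnth_behead; congr tnth.
by apply: val_inj; rewrite /= inordK // ltnS.
Qed.

Lemma consr_lt k r (ins : 'I_k -> nat) b :
  r < b -> (forall i, ins i < b) -> forall i, consr r ins i < b.
Proof. by move=> lt_r H i; rewrite /consr; case: unlift. Qed.

Lemma primrec_trace B S m y : primrec_graph B S m y ->
  exists z : nat -> nat,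
    [/\ B (z 0), forall j, j < m -> S j (z j) (z j.+1) & z m = y].
Proof.
elim: m y => [|m IHm] y /=; first by move=> By; exists (fun=> y); split.
case=> x /IHm[z [B0 St zm]] Sy; exists (fun j => if j == m.+1 then y else z j).
split=> [//|j lt_j|]; last by rewrite eqxx.
rewrite eqSS (ltn_eqF lt_j); case: eqP => [->|ne]; first by rewrite zm.
by apply: St; lia.
Qed.

(** Asked for all layouts at once, since the layout changes in recursive calls.
    *)
Definition implements k (c : murec k) v y := forall ins out fr s,
  (forall i, ins i < fr) -> out < fr -> (forall i, ins i <> out) ->
  (forall i, s (ins i) = tnth v i) -> (forall x, fr <= x -> s x = 0) ->
  does (cmd_of c ins out fr) s (upd s out (s out + y)).

(** [st A] is the store in which the results of the inner functions with index
    in [A] have been produced, in the registers from [fr] on. *)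
Lemma implements_comp k m (f : murec m) (h : 'I_m -> murec k) v w y :
  (forall i, implements (h i) v (tnth w i)) -> implements f w y ->
  implements (MuComp f h) v y.
Proof.
move=> Hh Hf ins out fr s lt_ins lt_out ne_out sv s0 /=.
pose st (A : pred nat) : store := fun x =>
  if (fr <= x) && A (x - fr) then nth 0 w (x - fr) else s x.
have st_low A x : x < fr -> st A x = s x.
  by move=> lt_x; rewrite /st [fr <= x]leqNgt lt_x.
have st_new (A : pred nat) (i : 'I_m) : A i -> st A (fr + i) = tnth w i.
  by rewrite /st leq_addr addKn (tnth_nth 0) => ->.
have st_old (A : pred nat) (i : 'I_m) : ~~ A i -> st A (fr + i) = 0.
  by rewrite /st leq_addr addKn => /negPf->; rewrite s0 ?leq_addr.
have st_high A x : fr + m <= x -> st A x = 0.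
  move=> ge_x; rewrite /st s0; last by lia.
  by rewrite nth_default ?if_same // size_tuple; lia.
have phase1 (r : seq 'I_m) (A : pred nat) :
    uniq r -> (forall i, i \in r -> ~~ A (i : 'I_m)) ->
  does (foldr (fun i => Seq (cmd_of (h i) ins (fr + i) (fr + m))) Skip r)
    (st A) (st (fun j => A j || (j \in [seq val i | i <- r]))).
  elim: r A => [|i r IHr] A /=.
    move=> _ _; apply: does_eqr (@does_skip _) _ => x.
    by rewrite /st; case: (A _).
  move=> /andP[ir ur] Ar; pose A' j := A j || (j == i).
  apply: (@does_seq _ _ _ (st A')).
    have H := Hh i ins (fr + i) (fr + m) (st A).
    apply: does_eqr (H _ _ _ _ _) _ => [i'||i'|i'|x|x].
    - exact/ltn_addr.
    - by rewrite ltn_add2l.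
    - by have := lt_ins i'; lia.
    - by rewrite st_low.
    - exact: st_high.
    rewrite st_old ?Ar ?mem_head // /upd; case: eqP => [->|ne].
      by rewrite st_new // /A' eqxx orbT.
    rewrite /st /A'; case: leqP => //= le_x; case: eqP => E; rewrite ?orbF //.
    by case: ne; rewrite -E subnKC.
  apply: does_eqr (IHr A' ur _) _ => [j jr|x].
    rewrite /A' negb_or Ar ?inE ?jr ?orbT //=.
    by apply: contraNneq ir => /val_inj <-.
  rewrite /st; congr (if _ && _ then _ else _).
  by rewrite /A' inE orbA.
apply: does_seq.
  apply: does_eq (phase1 (enum 'I_m) pred0 (enum_uniq _) _) _ (frefl _) => //.
  by move=> x; rewrite /st andbF.
have memE j : (j \in [seq val i | i <- enum 'I_m]) = (j < m).
  by rewrite val_enum_ord mem_iota.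
(* From here on all inner results are present. *)
set t := st _; have tn (i : 'I_m) : t (fr + i) = tnth w i.
  by apply: st_new; rewrite /= memE.
apply: does_seq.
  apply: (Hf _ _ _ t) => [i||i|i|x].
  - by rewrite ltn_add2l.
  - exact: ltn_addr.
  - by lia.
  - exact: tn.
  - exact: st_high.
apply: does_eqr (@does_clears _ _ _) _ => x.
rewrite /t st_low //; case: ifP => [/andP[ge_x _]|out_x].
  rewrite /upd; case: eqP => [E|_]; last by rewrite s0.
  by move: ge_x lt_out; rewrite E; lia.
rewrite /upd; case: eqP => // _; have [lt_x|ge_x] := ltnP x fr.
  exact: st_low.
by rewrite st_high ?s0 //; lia.
Qed.

Lemma implements_rec k (f : murec k) (h : murec k.+2) v (z : nat -> nat) m :
    thead v = m -> implements f [tuple of behead v] (z 0) ->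
    (forall j, j < m ->
      implements h [tuple of j :: z j :: [tuple of behead v]] (z j.+1)) ->
  implements (MuRec f h) v (z m).
Proof.
move=> vm Hf Hh ins out fr s lt_ins lt_out ne_out sv s0 /=.
have sz i : s (fr + i) = 0 by rewrite s0 ?leq_addr.
have := sz 0; have := sz 1; have := sz 2; have := sz 3.
rewrite addn0 addn1 addn2 addn3 => s3 s2 s1 s00.
have lt_tl i : tailr ins i < fr by apply: lt_ins.
have s_tl := tnth_tailr sv.
(* Accumulator, index and number of remaining steps after [j] steps. *)
pose st j := upd (upd (upd s fr (z j)) fr.+1 j) fr.+2 (m - j).
apply: (@does_seq _ _ _ (upd s fr (z 0))).
  apply: does_eqr (Hf _ _ _ _ _ _ _ s_tl _) _ => [i||i|x|x].
  - by apply: leq_trans (lt_tl i) _; lia.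
  - by lia.
  - by have := lt_tl i; lia.
  - by move=> ge_x; apply: s0; lia.
  - by upd_tac.
apply: (@does_seq _ _ _ (st 0)).
  have lt0 := lt_ins ord0; have sv0 := sv ord0.
  apply: does_eqr (@does_duplicate _ _ _ _ _ _ _ _) _ => [||||x];
    try by upd_tac.
  by have : tnth v ord0 = m := vm; rewrite /st; upd_tac.
apply: (@does_seq _ _ _ (st m)).
  apply: does_for => [j lt_j|]; last by rewrite /st; upd_tac.
  split; first by rewrite /st; upd_tac.
  apply: does_seq; first by apply: does_dec; rewrite /st; upd_tac.
  set t := upd _ _ _.
  have t_tl i : t (tailr ins i) = tnth [tuple of behead v] i.
    by rewrite -s_tl /t /st; have := lt_tl i; upd_tac.
  have tE x : t x = if x == fr.+2 then (m - j).-1 else st j x.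
    by rewrite /t /st; upd_tac.
  apply: does_seq.
    apply: (Hh j lt_j _ _ _ t) => [i||i||x].
    - apply: consr_lt; first by lia.
      by move=> i'; apply: consr_lt; [lia|move=> i2; have := lt_tl i2; lia].
    - by lia.
    - by rewrite /consr; case: unlift => [i1|]; [case: unlift => [i2|]|];
        [have := lt_tl i2|..]; lia.
    - apply: tnth_consr; first by rewrite tE /st; upd_tac.
      by apply: tnth_consr => //; rewrite tE /st; upd_tac.
    - by move=> ge_x; rewrite tE /st; have := s0 x; upd_tac.
  have t3 : t fr.+3 = 0 by rewrite tE /st; upd_tac.
  apply: does_seq; first exact: does_clear.
  apply: does_seq; first by apply: does_transfer; lia.
  apply: does_eqr (@does_inc _ _) _ => x.
  by rewrite {t_tl}; move: (tE) => {}tE; rewrite /upd t3 !tE /st; upd_tac.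
apply: does_seq; first by apply: does_transfer; lia.
apply: does_eqr (@does_clear _ _) _ => x; rewrite /st; upd_tac.
Qed.

(** Induction on the number of remaining candidates: a candidate below [y] has
    a nonzero test value, so the loop goes on, and at [y] it stops. *)
Lemma implements_min k (f : murec k.+1) (v : k.-tuple nat) y :
    implements f [tuple of y :: v] 0 ->
    (forall i, i < y -> exists x, implements f [tuple of i :: v] x.+1) ->
  implements (MuMin f) v y.
Proof.
move=> Hy Hi ins out fr s lt_ins lt_out ne_out sv s0 /=.
have value i : i <= y ->
    exists x, implements f [tuple of i :: v] x /\ (0 < x) = (i < y).
  rewrite leq_eqVlt => /orP[/eqP->|lt_i]; first by exists 0; rewrite !ltnn.
  by have [x Hx] := Hi i lt_i; exists x.+1; rewrite lt_i.
have sz i : s (fr + i) = 0 by rewrite s0 ?leq_addr.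
have := sz 0; have := sz 1; rewrite addn0 addn1 => s1 s00.
pose st i x := upd (upd s fr i) fr.+1 x.
have test i x (t : store) : implements f [tuple of i :: v] x -> t =1 st i 0 ->
    does (cmd_of f (consr fr ins) fr.+1 fr.+2) t (st i x).
  move=> Hx Et; apply: does_eqr (Hx _ _ _ t _ _ _ _ _) _ => [i'||i'||x'|x'].
  - by apply: consr_lt; [lia|move=> i2; have := lt_ins i2; lia].
  - by [].
  - by rewrite /consr; case: unlift => [i2|]; [have := lt_ins i2|]; lia.
  - apply: tnth_consr; first by rewrite Et /st; upd_tac.
    by move=> i'; rewrite Et -sv /st; have := lt_ins i'; upd_tac.
  - by move=> ge_x; rewrite Et /st; have := s0 x'; upd_tac.
  - by rewrite /upd !Et /st; upd_tac.
have [x0 [H0 x0P]] := value 0 (leq0n y).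
apply: (@does_seq _ _ _ (st 0 x0)).
  by apply: test => // x; rewrite /st; upd_tac.
apply: (@does_seq _ _ _ (st y 0)).
  have loop d i x : i + d = y -> implements f [tuple of i :: v] x ->
      (0 < x) = (i < y) ->
      does (Loop fr.+1 (Seq (clear fr.+1)
        (Seq (Inc fr) (cmd_of f (consr fr ins) fr.+1 fr.+2))))
        (st i x) (st y 0).
    elim: d i x => [|d IHd] i x Ed Hx xP.
      have -> : i = y by lia.
      have -> : x = 0 by move: xP; lia.
      by apply: does_stop; rewrite /st; upd_tac.
    have [x' [Hx' xP']] := value i.+1 ltac:(lia).
    apply: (does_loop _ _ (IHd _ _ _ Hx' xP')); last by lia.
      by rewrite /st; move: xP; upd_tac.
    apply: does_seq; first exact: does_clear.
    apply: does_seq; first exact: does_inc.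
    by apply: test => // x2; rewrite /st; upd_tac.
  exact: (loop y).
by apply: does_eqr (@does_transfer _ _ _ _) _ => [|x]; rewrite /st; upd_tac.
Qed.

Theorem cmd_of_correct k (c : murec k) v y : mueval c v y -> implements c v y.
Proof.
elim: c v y => {k} [||k i|k m f IHf h IHh|k f IHf h IHh|k f IHf] v y /=.
- move=> -> ins out fr s *; apply: does_eqr (@does_skip _) _ => x; upd_tac.
- move=> -> ins out fr s lt_ins lt_out ne_out sv s0 /=.
  have lt0 := lt_ins ord0; have ne0 := ne_out ord0; have sv0 := sv ord0.
  apply: does_seq; first by apply: does_duplicate => //; try lia; apply: s0.
  by apply: does_eqr (@does_inc _ _) _ => x; rewrite /thead -sv0; upd_tac.
- move=> -> ins out fr s lt_ins lt_out ne_out sv s0 /=.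
  have lti := lt_ins i; have nei := ne_out i; rewrite -sv.
  by apply: does_duplicate => //; try lia; apply: s0.
- move=> [w Hw Hy]; apply: implements_comp (IHf _ _ Hy) => i.
  exact: IHh.
- move=> /primrec_trace[z [B0 Sz <-]]; apply: implements_rec => //.
    exact: IHf.
  by move=> j lt_j; apply: IHh; apply: Sz.
- move=> [Hy Hi]; apply: implements_min; first exact: IHf.
  by move=> i /Hi[x Hx]; exists x; apply: IHf.
Qed.
End Registers.

(** * Total computable functions *)

(** The program is carried as data, so that the programs of a family of
    functions can be assembled by [MuComp] without choosing them. *)
Definition computable k (F : k.-tuple nat -> nat) :=
  {c : murec k | forall v, mueval c v (F v)}.

Section Computable.
Variable k : nat.
Implicit Types (F B N : k.-tuple nat -> nat).

Lemma computable_ext F F' : F =1 F' -> computable F -> computable F'.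
Proof. by move=> E [c Hc]; exists c => v; rewrite -E. Qed.

Lemma computable_proj i : computable (fun v : k.-tuple nat => tnth v i).
Proof. by exists (MuProj i). Qed.

Lemma computable_succ F : computable F -> computable (fun v => (F v).+1).
Proof.
case=> c Hc; exists (MuComp MuSucc (fun _ => c)) => v.
by exists [tuple F v] => // i; rewrite (ord1 i).
Qed.

Lemma computable_const a : computable (fun _ : k.-tuple nat => a).
Proof.
elim: a => [|a IHa]; last exact: computable_succ.
exists (MuComp MuZero (fun i : 'I_0 =>
  match i with Ordinal _ lt_i => False_rect _ (notF lt_i) end)) => v.
by exists [tuple] => // -[].
Qed.

Lemma computable_rec B (S : k.+2.-tuple nat -> nat) N :
  computable B -> computable S -> computable N ->
  computable (fun v => nat_rec (fun _ => nat) (B v)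
                         (fun m z => S [tuple of m :: z :: v]) (N v)).
Proof.
move=> [b Hb] [s Hs] [n Hn].
exists (MuComp (MuRec b s)
  (fun i => if unlift ord0 i is Some j then MuProj j else n)) => v.
exists [tuple of N v :: v].
  by move=> i; case: unliftP => [j|] ->; rewrite ?tnthS ?tnth0.
rewrite /= theadE.
suff H (u : k.-tuple nat) m : u = v -> primrec_graph (mueval b u)
    (fun m z => mueval s [tuple of m :: z :: u]) m
    (nat_rec (fun _ => nat) (B v) (fun m z => S [tuple of m :: z :: v]) m).
  by apply: H; apply: val_inj.
move=> ->; elim: m => [|m IHm] /=; first exact: Hb.
by eexists; [exact: IHm | exact: Hs].
Qed.

End Computable.

(** The function to iterate is given as a closure property at every arity,
    because it runs in the longer context of the recursion. *)
Lemma computable_iter k (B N : k.-tuple nat -> nat) (f : nat -> nat) :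
    (forall k' (F : k'.-tuple nat -> nat), computable F ->
       computable (fun v => f (F v))) ->
  computable B -> computable N -> computable (fun v => iter (N v) f (B v)).
Proof.
move=> cf cB cN; have c1 := computable_proj (lift ord0 ord0 : 'I_k.+2).
apply: computable_ext (computable_rec cB (cf _ _ c1) cN) => v /=.
by elim: (N v) => //= m <-; rewrite tnthS tnth0.
Qed.

Lemma computable_double k (F : k.-tuple nat -> nat) :
  computable F -> computable (fun v => (F v).*2).
Proof.
move=> cF; have cS k' (F' : k'.-tuple nat -> nat) : computable F' ->
    computable (fun v => (F' v).+2).
  by move=> c; do 2!apply: computable_succ.
have := computable_iter (f := fun m => m.+2) cS (computable_const _ 0) cF.
apply: computable_ext => v.
by elim: (F v) => // m IHm; rewrite iterS IHm doubleS.
Qed.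

(** The function that adds an entry in front of a coded sequence. *)
Definition push a b := 2 ^ a * b.*2.+1.

Arguments push : simpl never.

Lemma code_push s : CodeSeq.code s = foldr push 0 s.
Proof. by []. Qed.

Lemma computable_push k (F F' : k.-tuple nat -> nat) :
  computable F -> computable F' -> computable (fun v => push (F v) (F' v)).
Proof.
move=> cF cF'.
have := computable_iter computable_double
  (computable_succ (computable_double cF')) cF.
apply: computable_ext => v; rewrite /push; elim: (F v) => [|m IHm] /=.
  by rewrite mul1n.
by rewrite IHm expnS -mulnA mul2n.
Qed.

Lemma computable_exp2 k (F : k.-tuple nat -> nat) :
  computable F -> computable (fun v => 2 ^ F v).
Proof.
move=> cF; have := computable_push cF (computable_const _ 0).
apply: computable_ext => v.
by rewrite /push muln1.
Qed.

Lemma computable_pushes k (F : k.-tuple nat -> nat) w :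
  computable F -> computable (fun v => foldr push (F v) w).
Proof.
move=> cF; elim: w => //= a w; apply: computable_push.
exact: computable_const.
Qed.

Local Open Scope ring_scope.

(** * Sums of squares in an integral group ring *)

Section GroupRingTheory.
Variable G : groupType.
Local Notation ZG := (groupring int G).
Implicit Types (S T u v : ZG) (x : G) (c : int).

(** Locked: comparing monomials over a concrete group by conversion would
    unfold the group law. *)
Definition mono c x : ZG := locked << c *g x >>.

Lemma monoE c x : mono c x = << c *g x >>.
Proof. by rewrite /mono -lock. Qed.

Lemma monoM c1 c2 x1 x2 : mono c1 x1 * mono c2 x2 = mono (c1 * c2) (x1 * x2)%g.
Proof. by rewrite !monoE; apply: gr_mulUU. Qed.

Lemma monoN c x : mono (- c) x = - mono c x.
Proof. by rewrite !monoE; apply: monalgUN. Qed.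

Lemma mono1 : mono 1 1%g = 1.
Proof. by rewrite monoE. Qed.

Lemma coef_mono c x x' : (mono c x)@_x' = c *+ (x == x').
Proof. by rewrite !monoE; apply: mcoeffU. Qed.

Lemma groupring_ind (P : ZG -> Prop) :
  P 0 -> (forall S T, P S -> P T -> P (S + T)) -> (forall c x, P (mono c x)) ->
  forall S, P S.
Proof.
move=> P0 PD PU S; have -> : S = \sum_(k <- msupp S) mono S@_k k.
  by rewrite {1}[S]monalgE; apply: eq_bigr => x _; rewrite monoE.
by elim/big_ind: _ => // ? _; apply: PU.
Qed.

(** The adjoint; [star S * S] has the sum of the squares of the coefficients of
    [S] at the identity. *)
Definition star S : ZG := \sum_(x <- msupp S) mono S@_x (x^-1)%g.

Lemma coef_star S x : (star S)@_x = S@_(x^-1)%g.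
Proof.
rewrite /star raddf_sum [in RHS](monalgE S) raddf_sum /=.
by apply: eq_bigr => k _; rewrite coef_mono mcoeffU (can2_eq invgK invgK).
Qed.

Lemma starD : {morph star : S T / S + T}.
Proof. by move=> S T; apply/malgP => x; rewrite mcoeffD !coef_star mcoeffD. Qed.

Lemma star0 : star 0 = 0.
Proof. by apply/malgP => x; rewrite coef_star !mcoeff0. Qed.

Lemma star_mono c x : star (mono c x) = mono c (x^-1)%g.
Proof.
by apply/malgP => y; rewrite coef_star !coef_mono (can2_eq invgK invgK).
Qed.

Lemma starK : involutive star.
Proof. by move=> S; apply/malgP => x; rewrite !coef_star invgK. Qed.

Lemma starM S T : star (S * T) = star T * star S.
Proof.
elim/groupring_ind: S => [|S1 S2 IH1 IH2|c x].
- by rewrite mul0r star0 mulr0.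
- by rewrite mulrDl !starD IH1 IH2 mulrDr.
elim/groupring_ind: T => [|T1 T2 IH1 IH2|d y].
- by rewrite mulr0 star0 mul0r.
- by rewrite mulrDr !starD IH1 IH2 mulrDl.
- by rewrite monoM !star_mono monoM invgM mulrC.
Qed.

Lemma coef1_starM S T :
  (star S * T)@_1%g = \sum_(x <- msupp S) S@_x * T@_x.
Proof.
elim/groupring_ind: T => [|T1 T2 IH1 IH2|c y].
- by rewrite mulr0 mcoeff0 big1 // => x _; rewrite mcoeff0 mulr0.
- rewrite mulrDr mcoeffD IH1 IH2 -big_split; apply: eq_bigr => x _.
  by rewrite mcoeffD mulrDr.
rewrite /star mulr_suml raddf_sum; apply: eq_bigr => x _.
by rewrite monoM /= !coef_mono mulrnAr mulg_eq1 eqg_inv eq_sym.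
Qed.

Lemma starM_eq0 S : ((star S * S)@_1%g == 0) = (S == 0).
Proof.
rewrite coef1_starM; apply/eqP/eqP => [|->]; last first.
  by rewrite big1 // => x _; rewrite mcoeff0 mulr0.
move=> /eqP; rewrite psumr_eq0 => [/allP H|x _]; last by rewrite -expr2 sqr_ge0.
apply/malgP => x; rewrite mcoeff0; case: (msuppP S x) => // xS.
by have /H /= := xS; rewrite mulf_eq0 orbb => /eqP.
Qed.

Lemma starM_ge0 S : 0 <= (star S * S)@_1%g.
Proof. by rewrite coef1_starM sumr_ge0 // => x _; rewrite -expr2 sqr_ge0. Qed.

Definition sum_squares (us : seq ZG) : ZG := \sum_(u <- us) star u * u.

Lemma sum_squares_selfadjoint us : star (sum_squares us) = sum_squares us.
Proof.
rewrite /sum_squares (big_morph star starD star0).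
by apply: eq_bigr => u _; rewrite starM starK.
Qed.

Lemma sum_squares_annihilated us S :
  sum_squares us * S = 0 <-> forall u, u \in us -> u * S = 0.
Proof.
split=> [TS0|H]; last first.
  rewrite /sum_squares mulr_suml big_seq big1 // => u /H uS0.
  by rewrite -mulrA uS0 mulr0.
have E : \sum_(u <- us) (star (u * S) * (u * S))@_1%g = 0.
  transitivity ((star S * (sum_squares us * S))@_1%g); last first.
    by rewrite TS0 mulr0 mcoeff0.
  rewrite /sum_squares mulr_suml mulr_sumr raddf_sum /=; apply: eq_bigr => u _.
  by rewrite starM !mulrA.
move=> u uus; move/eqP: E; rewrite psumr_eq0 => [/allP E|v _]; last first.
  exact: starM_ge0.
by have := E _ uus; rewrite /= starM_eq0 => /eqP.
Qed.

(** Self-adjointness turns a left annihilator into a right one. *)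
Lemma zero_divisor_sum_squares us :
  zero_divisor (sum_squares us) <->
  exists2 S : ZG, S != 0 & forall u, u \in us -> u * S = 0.
Proof.
split=> [[S S0 [TS|ST]]|[S S0 H]]; last first.
- by exists S => //; left; apply/sum_squares_annihilated.
- exists (star S).
    by apply: contra_neq S0 => E; rewrite -(starK S) E star0.
  apply/sum_squares_annihilated.
  by rewrite -sum_squares_selfadjoint -starM ST star0.
- by exists S => //; apply/sum_squares_annihilated.
Qed.

(** If [x] acts as the sign [e] then [branch x S T] acts as twice [S] for [e =
    1] and as twice [T] for [e = - 1]: a case distinction on the content of one
    cell. *)
Definition branch x S T : ZG := (1 + mono 1 x) * S + (1 - mono 1 x) * T.

Lemma branchM x S T u :
  branch x S T * u =
    (S * u + mono 1 x * (S * u)) + (T * u - mono 1 x * (T * u)).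
Proof. by rewrite /branch mulrDl -!mulrA mulrDl mulrBl !mul1r. Qed.

(** Kills an element that [S] cannot tell from its translate by [x]. *)
Definition translation_gap S x : ZG := S * (1 - mono 1 x).

Lemma translation_gapM S x u : translation_gap S x * u = S * (u - mono 1 x * u).
Proof. by rewrite /translation_gap -mulrA mulrBl mul1r. Qed.

Section Corner.
Variables (c : int) (x z : G).
Hypotheses (c2 : c * c = 1) (x2 : (x * x = 1)%g) (z2 : (z * z = 1)%g).
Hypothesis xz : commute x z.

(** For commuting involutions this is four times the projection onto the
    vectors on which [x] acts as [- 1] and [z] as [- c]. *)
Definition corner : ZG := (1 - mono 1 x) * (1 - mono c z).

Lemma cornerM u : corner * u =
  (u - mono c z * u) - mono 1 x * (u - mono c z * u).
Proof. by rewrite /corner -mulrA mulrBl mulrBl !mul1r. Qed.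

Lemma corner_star_square : star corner * corner =
  mono 4 1%g + mono (- 4) x + mono (- (4 * c)) z + mono (4 * c) (x * z)%g.
Proof.
have mono4 d t : mono (4 * d) t = mono d t *+ 4.
  by rewrite mulr_natl !monoE monalgUMn.
rewrite -(mulr1 4) -[- (4 * 1)]mulrN -[- (4 * c)]mulrN !mono4 -!mulrnDl.
have inv_id (t : G) : (t * t = 1)%g -> (t^-1 = t)%g.
  by move=> t2; rewrite -{1}(mulg1 (t^-1)%g) -t2 mulKg.
have sB d t : (t * t = 1)%g -> star (1 - mono d t) = 1 - mono d t.
  by move=> t2; rewrite -monoN starD -mono1 !star_mono invg1 inv_id.
have B2 d t : d * d = 1 -> (t * t = 1)%g ->
    (1 - mono d t) * (1 - mono d t) = (1 - mono d t) *+ 2.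
  move=> d2 t2; rewrite mulrBl mul1r mulrBr mulr1 monoM t2 d2 mono1.
  by rewrite opprB mulr2n.
have regroup (V : zmodType) (a b p q : V) : a - b + (p - q) = a - q - b + p.
  by rewrite addrA addrAC [a - b - q]addrAC.
have cm : (1 - mono c z) * (1 - mono 1 x) = (1 - mono 1 x) * (1 - mono c z).
  have ab : GRing.comm (mono c z) (mono 1 x).
    by rewrite /GRing.comm !monoM mulrC xz.
  apply: commrB; first exact: commr1.
  by apply/commr_sym/commrB; [apply: commr1 | apply: commr_sym].
rewrite /corner starM !sB // mulrA -(mulrA (1 - mono c z)) B2 // mulrnAr.
rewrite mulrnAl cm -mulrA B2 // mulrnAr -mulrnA.
rewrite mulrBl mul1r mulrBr mulr1 monoM mul1r -mono1 !monoN opprB.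
by rewrite regroup.
Qed.
End Corner.

End GroupRingTheory.

(** * Fourier transform of the group ring of four lamplighters *)

Local Notation L4 := {ffun 'I_4 -> lamplighter}.
Local Notation ZL4 := (groupring int L4).
Local Notation lamps := {malg 'Z_2[int]}.

(** A character of the direct sum of the lamps: the bit of a cell tells whether
    the lamp of that cell acts as [- 1]. *)
Definition tape := 'I_4 -> int -> bool.
Local Notation pos := {ffun 'I_4 -> int}.

Section Fourier.
Implicit Types (y : tape) (h : pos) (k : 'I_4) (j : int) (g : L4) (S : ZL4).

Definition view y h : tape := fun k j => y k (h k + j).

Definition lamp_at k j : L4 :=
  [ffun i => if i == k then ((<< 1 *g j >>, 0) : lamplighter) else 1%g].
Definition translation (p : pos) : L4 := [ffun k => ((0, p k) : lamplighter)].

Definition sgn (a : 'Z_2) : int := (-1) ^+ (a : nat).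

Lemma Z2P (a : 'Z_2) : a = 0 \/ a = 1.
Proof. by case: a => [[|[|]]] // ?; [left|right]; apply: val_inj. Qed.

Lemma sgnD : {morph sgn : a b / a + b >-> a * b}.
Proof. by move=> a b; case: (Z2P a) => ->; case: (Z2P b) => ->. Qed.

Lemma sgn_sqr a : sgn a * sgn a = 1.
Proof. by case: (Z2P a) => ->. Qed.

Lemma sgn_neq0 a : sgn a != 0.
Proof. by case: (Z2P a) => ->. Qed.

(** The exponent of the character given by the bits [z]. *)
Definition dot (z : int -> bool) (f : lamps) : 'Z_2 :=
  mmap idfun (fun j => (z j)%:R) f.

Lemma dotD z : {morph dot z : f1 f2 / f1 + f2}.
Proof. by move=> f1 f2; rewrite /dot mmapD. Qed.

Lemma dot0 z : dot z 0 = 0.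
Proof. exact: mmap0. Qed.

Lemma dotU z j : dot z << 1 *g j >> = (z j)%:R.
Proof. by rewrite /dot mmapU mul1r. Qed.

Lemma eq_dot z1 z2 f : z1 =1 z2 -> dot z1 f = dot z2 f.
Proof. by move=> E; apply: eq_bigr => j _; rewrite E. Qed.

Lemma dot_shift z n f : dot z (shift n f) = dot (fun i => z (n + i)) f.
Proof.
rewrite /shift /dot raddf_sum /=; apply: eq_bigr => i _.
by rewrite mmapU addrC.
Qed.

Lemma dot_flip z j f :
  dot (fun i => z i (+) (i == j)) f = dot z f + f@_j.
Proof.
have -> : f@_j = \sum_(i <- msupp f) f@_i * (i == j)%:R.
  rewrite {1}(monalgE f) raddf_sum; apply: eq_bigr => i _.
  by rewrite /= mcoeffU mulr_natr.
rewrite /dot /mmap -big_split; apply: eq_bigr => i _ /=.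
by rewrite -mulrDr; congr (_ * _); case: (z i); case: (i == j); apply: val_inj.
Qed.

Definition tape_char y g : int := \prod_(k < 4) sgn (dot (y k) (g k).1).

(** The sign makes a lamp at [j] read the cell [j] steps to the right of the
    head. *)
Definition pos_of g : pos := [ffun k => - (g k).2].

(** The function of the head position that the character [y] attaches to a
    group element: it is supported at one position, and the lamps are read
    relative to it. *)
Definition fourier_term y h g : int :=
  if pos_of g == h then tape_char (view y h) g else 0.

Definition fourier y h : ZL4 -> int := mmap idfun (fourier_term y h).

HB.instance Definition _ y h := GRing.Additive.on (fourier y h).

Lemma fourier_mono y h c g : fourier y h (mono c g) = c * fourier_term y h g.
Proof. by rewrite monoE; apply: mmapU. Qed.

Lemma L4M (g g' : L4) k :
  ((g * g')%g k) = ((g k).1 + shift (g k).2 (g' k).1, (g k).2 + (g' k).2).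
Proof. by rewrite ffunE. Qed.

Lemma fourierD y h S T : fourier y h (S + T) = fourier y h S + fourier y h T.
Proof. exact: raddfD. Qed.

Lemma fourierB y h S T : fourier y h (S - T) = fourier y h S - fourier y h T.
Proof. exact: raddfB. Qed.

Lemma fourier0 y h : fourier y h 0 = 0.
Proof. exact: raddf0. Qed.

Lemma fourier_term_lamp y h k j g :
  fourier_term y h (lamp_at k j * g)%g =
    (-1) ^+ (y k (h k + j)) * fourier_term y h g.
Proof.
have -> : fourier_term y h (lamp_at k j * g)%g =
    if pos_of g == h then tape_char (view y h) (lamp_at k j * g)%g else 0.
  congr (if _ == h then _ else _); apply/ffunP => i; rewrite !ffunE.
  by case: eqP; rewrite /= add0r.
rewrite /fourier_term; case: ifP => _; last by rewrite mulr0.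
rewrite /tape_char (bigD1 k) //= [in RHS](bigD1 k) //= mulrA; congr (_ * _).
  rewrite L4M ffunE eqxx /= shift0 dotD sgnD dotU /view.
  by case: (y k _).
apply: eq_bigr => i /negPf ik.
by rewrite L4M ffunE ik /= shift0 add0r.
Qed.

Lemma fourier_term_translation y h p g :
  fourier_term y h (translation p * g)%g = fourier_term y (h + p) g.
Proof.
rewrite /fourier_term.
have -> : (pos_of (translation p * g)%g == h) = (pos_of g == h + p).
  rewrite -subr_eq; congr (_ == _); apply/ffunP => k.
  by rewrite !ffunE /= opprD addrC.
case: ifP => // _; apply: eq_bigr => k _; congr sgn.
rewrite L4M ffunE /= add0r dot_shift; apply: eq_dot => i.
by rewrite /view !ffunE addrA.
Qed.

Lemma fourier_lamp y h c k j S :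
  fourier y h (mono c (lamp_at k j) * S) =
    c * (-1) ^+ (y k (h k + j)) * fourier y h S.
Proof.
elim/groupring_ind: S => [|S T IHS IHT|d g].
- by rewrite mulr0 raddf0 mulr0.
- by rewrite mulrDr !raddfD /= IHS IHT mulrDr.
- by rewrite monoM !fourier_mono fourier_term_lamp mulrACA mulrA.
Qed.

Lemma fourier_translation y h p S :
  fourier y h (mono 1 (translation p) * S) = fourier y (h + p) S.
Proof.
elim/groupring_ind: S => [|S T IHS IHT|c g]; first by rewrite mulr0 !raddf0.
  by rewrite mulrDr !raddfD /= IHS IHT.
by rewrite monoM !fourier_mono fourier_term_translation mul1r.
Qed.

Lemma fourier1 y h : fourier y h 1 = (h == 0)%:R.
Proof.
rewrite -mono1 fourier_mono mul1r /fourier_term.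
have -> : pos_of 1%g = 0 by apply/ffunP => k; rewrite !ffunE oppr0.
rewrite eq_sym; case: ifP => // _; rewrite /tape_char big1 // => k _.
by rewrite ffunE /= dot0.
Qed.

Lemma fourier_supp y h S :
  fourier y h S != 0 -> h \in [seq pos_of g | g <- msupp S].
Proof.
apply: contraR => hS; apply/eqP; rewrite /fourier /mmap big_seq big1 // => g gS.
rewrite /fourier_term; case: eqP => [E|]; last by rewrite mulr0.
by rewrite -E map_f in hS.
Qed.

(** Changing one bit of the character separates the group elements according to
    the lamp of that cell. *)
Definition flip y k0 j0 : tape := fun k j => y k j (+) ((k == k0) && (j == j0)).

Lemma fourier_term_flip y h k j g :
  fourier_term (flip y k (h k + j)) h g = sgn ((g k).1@_j) * fourier_term y h g.
Proof.
rewrite /fourier_term; case: ifP => _; last by rewrite mulr0.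
rewrite /tape_char (bigD1 k) //= [in RHS](bigD1 k) //= mulrA.
rewrite mulrC [in RHS]mulrC.
congr (_ * _).
  apply: eq_bigr => i /negPf ik; congr sgn; apply: eq_dot => l.
  by rewrite /view /flip ik addbF.
rewrite mulrC -sgnD -dot_flip; congr sgn; apply: eq_dot => l.
by rewrite /view /flip eqxx (inj_eq (addrI _)).
Qed.

Lemma separating_cell g g' : pos_of g = pos_of g' -> g != g' ->
  exists d : 'I_4 * int, sgn ((g d.1).1@_d.2) * sgn ((g' d.1).1@_d.2) = -1.
Proof.
move=> Ep gg'.
have /existsP[k /eqP kP] : [exists k, g k != g' k].
  apply: contraR gg'; rewrite negb_exists => /forallP E; apply/eqP/ffunP => k.
  by apply/eqP; have := E k; rewrite negbK.
have E2 : (g k).2 = (g' k).2.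
  by move/ffunP/(_ k): Ep; rewrite !ffunE => /oppr_inj.
have nz : (g k).1 - (g' k).1 != 0.
  apply/eqP => /subr0_eq E1; apply: kP; move: E1 E2.
  by case: (g k) (g' k) => [? ?] [? ?] /= -> ->.
have [E|[j]] := fset_0Vmem (msupp ((g k).1 - (g' k).1)).
  case/eqP: nz; apply/malgP => j; rewrite mcoeff0 mcoeff_outdom //.
  by rewrite E in_fset0.
rewrite -mcoeff_neq0 mcoeffB => jP; exists (k, j) => /=.
move: jP; case: (Z2P ((g k).1@_j)) => ->; case: (Z2P ((g' k).1@_j)) => -> //.
Qed.

(** Independence of characters. Fix [g0] in the support. For a cell [d], adding
    to the transform the one for the tape flipped at [d], multiplied by the
    sign of [g0] at [d], doubles the contributions of the elements that agree
    with [g0] at [d] and kills the others. Doing so for finitely many cells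
    isolates [g0], and a combination of transforms that is nonzero has a
    nonzero term. *)
Lemma fourier_neq0 S : S != 0 -> exists y h, fourier y h S != 0.
Proof.
move=> S0; have [g0 g0S] : exists g, g \in msupp S.
  have [E|[g gS]] := fset_0Vmem (msupp S); last by exists g.
  case/eqP: S0; apply/malgP => g; rewrite mcoeff0 mcoeff_outdom //.
  by rewrite E in_fset0.
pose s g (d : 'I_4 * int) := sgn ((g d.1).1@_d.2).
pose h := pos_of g0.
pose twist D y := \sum_(g <- msupp S)
    S@_g * (\prod_(d <- D) (1 + s g0 d * s g d)) * fourier_term y h g.
have untwist D y : twist D y != 0 -> exists y', fourier y' h S != 0.
  elim: D y => [|[k j] D IHD] y nz.
    exists y; apply: contra_neq nz => <-; apply: eq_bigr => g _.
    by rewrite big_nil mulr1.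
  have E : twist ((k, j) :: D) y =
      twist D y + s g0 (k, j) * twist D (flip y k (h k + j)).
    rewrite /twist mulr_sumr -big_split; apply: eq_bigr => g _ /=.
    by rewrite big_cons fourier_term_flip {1 4}/s /=; ring.
  have [E0|] := eqVneq (twist D y) 0; last exact: IHD.
  have [E1|] := eqVneq (twist D (flip y k (h k + j))) 0; last exact: IHD.
  by rewrite E E0 E1 mulr0 addr0 eqxx in nz.
have sep (t : seq L4) : exists D : seq ('I_4 * int), forall g, g \in t ->
    pos_of g = h -> g != g0 -> exists2 d, d \in D & s g0 d * s g d = -1.
  elim: t => [|g t [D HD]]; first by exists [::].
  case: (eqVneq (pos_of g) h) => [Eg|Ng]; last first.
    exists D => x; rewrite inE => /orP[/eqP->|xt]; last exact: HD.
    by move=> E; rewrite E eqxx in Ng.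
  case: (eqVneq g g0) => [->|gg0].
    exists D => x; rewrite inE => /orP[/eqP->|xt]; first by rewrite eqxx.
    exact: HD.
  have [||d Hd] := @separating_cell g0 g; [by rewrite Eg|by rewrite eq_sym|].
  exists (d :: D) => x; rewrite inE => /orP[/eqP->|xt] Ex xg0.
    by exists d; rewrite ?mem_head.
  by have [e eD He] := HD _ xt Ex xg0; exists e; rewrite ?inE ?eD ?orbT.
have [D HD] := sep (msupp S).
have [|y nz] := untwist D (fun _ _ => false); last by exists y, h.
rewrite /twist (big_fsetD1 g0) //= [X in _ + X]big_seq [X in _ + X]big1 ?addr0.
  rewrite /fourier_term eqxx !mulf_neq0 ?mcoeff_neq0 //.
    by rewrite prodf_seq_neq0; apply/allP => d _; rewrite sgn_sqr.
  by rewrite /tape_char prodf_seq_neq0; apply/allP => k _; apply: sgn_neq0.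
move=> g; rewrite in_fsetD1 => /andP[gg0 gS].
rewrite /fourier_term; case: eqP => [Eg|]; last by rewrite mulr0.
have [d dD Hd] := HD _ gS Eg gg0.
by rewrite (big_rem d) //= Hd subrr mul0r mulr0 mul0r.
Qed.

Lemma fourier_inj S : (forall y h, fourier y h S = 0) -> S = 0.
Proof.
move=> S0; apply/eqP; apply: contraT => /fourier_neq0[y [h]].
by rewrite S0 eqxx.
Qed.
End Fourier.

(** * Local laws and annihilators *)

Section Laws.
Implicit Types (y : tape) (h : pos) (k : 'I_4) (j : int) (S : ZL4).
Implicit Types (D : seq ('I_4 * int)) (c : tape -> bool) (f : pos -> int).

Definition depends_on D c :=
  forall y y', (forall d, d \in D -> y d.1 d.2 = y' d.1 d.2) -> c y = c y'.

(** Fixing the value of a cell that has been read makes a condition independent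
    of that cell, which drives the recursion of [local_elt]. *)
Definition set_cell (d : 'I_4 * int) b y : tape :=
  fun k j => if (k, j) == d then b else y k j.

(** Acts as a multiple of the projection onto the positions where the condition
    [c] holds, by reading the cells of [D] one after the other. The factor [2
    ^+ size D] comes from [branch]. *)
Fixpoint local_elt D c : ZL4 :=
  if D is d :: D' then
    branch (lamp_at d.1 d.2) (local_elt D' (c \o set_cell d false))
                             (local_elt D' (c \o set_cell d true))
  else if c (fun _ _ => false) then 1 else 0.

Lemma fourier_branch y h k j A B S :
  let e := (-1) ^+ (y k (h k + j)) in
  fourier y h (branch (lamp_at k j) A B * S) =
    (1 + e) * fourier y h (A * S) + (1 - e) * fourier y h (B * S).
Proof.
move=> e; rewrite branchM fourierD; congr (_ + _).
  rewrite fourierD [RHS]mulrDl; congr (_ + _); first by rewrite [RHS]mul1r.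
  by rewrite -[e]mul1r; apply: fourier_lamp.
rewrite fourierB [RHS]mulrBl; congr (_ - _); first by rewrite [RHS]mul1r.
by rewrite -[e]mul1r; apply: fourier_lamp.
Qed.

Lemma fourier_local_elt D c y h S : depends_on D c ->
  fourier y h (local_elt D c * S) =
    2 ^+ size D * (c (view y h))%:R * fourier y h S.
Proof.
elim: D c S => [|[k j] D IHD] c S loc /=.
  rewrite (loc (view y h) (fun _ _ => false)) // mul1r.
  by case: ifP; rewrite ?mul1r // mul0r fourier0 mul0r.
have locD b : depends_on D (c \o set_cell (k, j) b).
  move=> y1 y2 E; apply: loc => -[k' j']; rewrite inE /set_cell /=.
  by case: eqP => //= _; apply: E.
have fixed b : view y h k j = b ->
    c (set_cell (k, j) b (view y h)) = c (view y h).
  move=> E; apply: loc => -[k' j'] _; rewrite /set_cell /=.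
  by case: eqP => // -[-> ->].
have HA := IHD _ S (locD false); have HB := IHD _ S (locD true).
move: (local_elt D _) (local_elt D _) HA HB => A B HA HB.
rewrite fourier_branch.
rewrite [X in _ * X + _]HA [X in _ + _ * X]HB exprS /=.
have := fixed _ erefl; rewrite /view.
by case: (y k (h k + j)) => ->; ring.
Qed.

(** A condition on the tapes as seen from the heads, and what it demands:
    [None] that the function vanishes, [Some p] that it does not change when
    the heads move by [p]. *)
Definition law := ((tape -> bool) * option pos)%type.

Definition target f (og : option pos) h :=
  if og is Some p then f (h + p) else 0.

Definition obeys (l : law) y f :=
  forall h, l.1 (view y h) -> f h = target f l.2 h.

Definition enforces (us : seq ZL4) (P : tape -> (pos -> int) -> Prop) :=
  forall S,
    (forall u, u \in us -> u * S = 0) <-> forall y, P y (fourier y ^~ S).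

(** Injectivity of the transform gives the converse direction. *)
Lemma enforces_law u (a : int) (l : law) : a != 0 ->
    (forall y h S, fourier y h (u * S) =
      a * (l.1 (view y h))%:R *
      (fourier y h S - target (fourier y ^~ S) l.2 h)) ->
  enforces [:: u] (obeys l).
Proof.
move=> a0 H S; split=> [uS y h lh|ob u'].
  have := H y h S; rewrite uS ?mem_head // fourier0 lh mulr1 => /esym/eqP.
  by rewrite mulf_eq0 (negPf a0) subr_eq0 => /eqP.
rewrite inE => /eqP->; apply: fourier_inj => y h; rewrite H.
case lh: (l.1 _); last by rewrite mulr0 mul0r.
by rewrite (ob y h lh) subrr mulr0.
Qed.

Lemma enforces_cat us vs P Q : enforces us P -> enforces vs Q ->
  enforces (us ++ vs) (fun y f => P y f /\ Q y f).
Proof.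
move=> HP HQ S; split=> [H y|H u].
  split; first by apply: (proj1 (HP S)) => u uus; apply: H; rewrite mem_cat uus.
  by apply: (proj1 (HQ S)) => u uvs; apply: H; rewrite mem_cat uvs orbT.
rewrite mem_cat => /orP[uus|uvs].
  by apply: (proj2 (HP S)) uus => y; case: (H y).
by apply: (proj2 (HQ S)) uvs => y; case: (H y).
Qed.

Lemma enforces_map (I : eqType) (s : seq I) (F : I -> ZL4) P :
    (forall i, i \in s -> enforces [:: F i] (P i)) ->
  enforces [seq F i | i <- s] (fun y f => forall i, i \in s -> P i y f).
Proof.
move=> H S; split=> [E y i si|E u /mapP[i si ->]].
  by apply: (proj1 (H i si S)) => u; rewrite inE => /eqP->; apply/E/map_f.
by apply: (proj2 (H i si S)); [move=> y; apply: E | rewrite mem_head].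
Qed.

Definition law_elt D (l : law) : ZL4 :=
  if l.2 is Some p then translation_gap (local_elt D l.1) (translation p)
  else local_elt D l.1.

Lemma enforces_law_elt D l : depends_on D l.1 ->
  enforces [:: law_elt D l] (obeys l).
Proof.
move=> loc; apply: (enforces_law (a := 2 ^+ size D)).
  by rewrite expf_neq0.
move=> y h S; rewrite /law_elt; case: l.2 => [p|] /=.
  by rewrite translation_gapM fourier_local_elt // fourierB fourier_translation.
by rewrite fourier_local_elt // subr0.
Qed.

(** The cylinder of all tapes that look like [y] on the cells of [D]. *)
Definition agree y D y' := all (fun d => y' d.1 d.2 == y d.1 d.2) D.

Definition cyl_elt y D : ZL4 := local_elt D (agree y D).

Lemma agree_depends y D : depends_on D (agree y D).
Proof. by move=> y1 y2 E; apply: eq_in_all => d /E->. Qed.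

(** The transform of this element is a multiple of the indicator of [C] on
    tapes that agree with [y] on [D], and zero on all others. *)
Definition config_elt y D (C : seq pos) : ZL4 :=
  \sum_(p <- C) mono 1 (translation (- p)) * cyl_elt y D.

Lemma fourier_config_elt y D C y' h : uniq C ->
  fourier y' h (config_elt y D C) =
    2 ^+ size D * (agree y D y' && (h \in C))%:R.
Proof.
move=> uC; rewrite /config_elt raddf_sum /=.
have E p : fourier y' h (mono 1 (translation (- p)) * cyl_elt y D) =
    2 ^+ size D * (agree y D y')%:R * (h == p)%:R.
  rewrite fourier_translation -[cyl_elt _ _]mulr1 fourier_local_elt;
    last exact: agree_depends.
  rewrite fourier1 subr_eq0; case: (h =P p) => [->|_]; last by rewrite !mulr0.
  rewrite subrr; congr (_ * (nat_of_bool _)%:R * _).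
  by apply: agree_depends => d _; rewrite /view ffunE add0r.
rewrite (eq_bigr _ (fun p _ => E p)) -mulr_sumr -mulrA; congr (_ * _).
rewrite -mulnb natrM; congr (_ * _).
case: (boolP (h \in C)) => hC.
  rewrite (big_rem h) //= eqxx big_seq big1 ?addr0 // => p.
  by rewrite mem_rem_uniq // inE eq_sym => /andP[/negPf-> _].
rewrite big_seq big1 // => p pC; case: eqP => // E'.
by rewrite E' pC in hC.
Qed.

Definition ball (r : nat) : seq ('I_4 * int) :=
  [seq (k, i%:Z - r%:Z) | k <- enum 'I_4, i <- iota 0 (r + r).+1].

Lemma mem_ball r k j : (k, j) \in ball r = (`|j| <= r)%N.
Proof.
apply/allpairsP/idP => [[[k' i] /= [_ Hi [_ ->]]]|le_jr].
  by rewrite inE mem_iota in Hi; lia.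
exists (k, `|(j + r%:Z)%R|%N); rewrite mem_enum mem_iota.
split=> //=; first lia.
by congr (_, _); lia.
Qed.

(** The window [D] covers all that the laws can read from positions in [C] and
    from positions that one of the moves [Gs] takes into [C]. At other
    positions both sides of a law are zero, and on other tapes the whole
    transform is. *)
Lemma exists_annihilated y (C Gs : seq pos) r : uniq C -> C != [::] ->
  exists2 S, S != 0 & forall l : law, depends_on (ball r) l.1 ->
    (if l.2 is Some p then p \in Gs else true) ->
    (forall h, l.1 (view y h) ->
      (h \in C) = if l.2 is Some p then h + p \in C else false) ->
    forall y', obeys l y' (fourier y' ^~ S).
Proof.
move=> uC C0; pose C' := C ++ [seq p - q | p <- C, q <- Gs].
pose D := [seq (d.1, (p : pos) d.1 + d.2) | p <- C', d <- ball r].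
exists (config_elt y D C).
  case: C C0 @C' @D uC => // p C _ C' D uC.
  apply/eqP => E; have := fourier_config_elt y D y p uC.
  rewrite E fourier0 mem_head andbT => /esym/eqP.
  rewrite mulf_eq0 expf_eq0 andbF orFb.
  by rewrite (_ : agree y D y) //; apply/allP => d _ /=.
move=> [c og] /= loc oG cl y' h /= ch; rewrite /= !fourier_config_elt //.
have -> : target (fun h' => fourier y' h' (config_elt y D C)) og h =
    2 ^+ size D *
    (agree y D y' && (if og is Some p then h + p \in C else false))%:R.
  by case: og {oG cl} => [p|] /=; rewrite ?fourier_config_elt // andbF mulr0.
case: (boolP (agree y D y')) => [ag|_]; last by rewrite !andFb.
rewrite !andTb; congr (_ * (nat_of_bool _)%:R).
have inC' : h \in C' -> c (view y h).
  move=> hC'; rewrite (loc _ (view y' h)) // => d dr; apply/esym/eqP.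
  have dD : (d.1, h d.1 + d.2) \in D by apply/allpairsP; exists (h, d).
  exact: (allP ag _ dD).
case: (boolP (h \in C')) => [/inC'/cl-> //|].
rewrite mem_cat negb_or => /andP[/negPf-> hG].
case: og oG {cl} => [p pG|//]; apply/esym/negbTE.
apply: contra hG => hp.
by apply/allpairsP; exists (h + p, p); rewrite addrK.
Qed.
End Laws.

(** * Run certificates on tapes *)

Definition tape0 : 'I_4 := Ordinal (isT : (0 < 4)%N).
Definition tape1 : 'I_4 := Ordinal (isT : (1 < 4)%N).
Definition tape2 : 'I_4 := Ordinal (isT : (2 < 4)%N).
(** The mark on the tape of a counter is its zero: the value is the distance of
    the head to the first mark on its left. *)
Definition ctape (c : bool) : 'I_4 := if c then tape1 else tape0.


Section Certificate.
Variable P : program.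
Let m := size P.
(** An entry of the certificate consists of the start bit, the branch bit and
    one bit for each state. *)
Definition width : nat := (size P).+2.

Implicit Types (y : tape) (h : pos) (f : pos -> int).

Definition start y := y tape2 0.
Definition branch_bit y := y tape2 1.
(** The position of the first true bit: every bit pattern is the entry of some
    state, and an entry without true bits, in particular blank tape, is in the
    accepting state. *)
Definition state y : nat :=
  find (fun i : nat => y tape2 (i.+2)%:Z) (iota 0 m).

Definition back y : tape :=
  fun k j => if k == tape2 then y k (j - width%:Z) else y k j.

Definition next_state q b :=
  match fetch P q with
  | IncBy _ _ q' => q'
  | DecBy _ _ q1 q2 => if b then q1 else q2
  end.

(** An increment may not pass a mark, since the distance to the first mark
    would then be wrong; the branch bit of a decrement must be the outcome of
    the test, which is visible on the tape. *)
Definition op_ok y :=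
  if (state y < m)%N then
    match fetch P (state y) with
    | IncBy c k _ => all (fun j : nat => ~~ y (ctape c) j%:Z) (iota 1 k)
    | DecBy c k _ _ =>
        branch_bit y == all (fun j : nat => ~~ y (ctape c) (- j%:Z)) (iota 0 k)
    end
  else true.

(** A start entry is preceded by an accepting one, from which no move leads on:
    this separates the beginning of a run from whatever is on its left. All
    other entries continue the previous one. *)
Definition link_ok y :=
  if start y then [&& state (back y) == m, state y == 0%N & y tape1 0]
  else (state (back y) < m)%N &&
       (state y == next_state (state (back y)) (branch_bit (back y))).

Definition defect y := ~~ (op_ok y && link_ok y).

(** Depends on the entry only and not on the counters, so that moves can be
    undone. *)
Definition displacement q b : pos := [ffun k =>
  if k == tape2 then width%:Z else
  match fetch P q with
  | IncBy c d _ => if k == ctape c then d%:Z else 0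
  | DecBy c d _ _ => if b && (k == ctape c) then - d%:Z else 0
  end].

Definition defect_law : law := (defect, None).
Definition edge_law (qb : nat * bool) : law :=
  (fun y => (state y == qb.1) && (branch_bit y == qb.2),
   Some (displacement qb.1 qb.2)).

Definition edge_index : seq (nat * bool) :=
  [seq (q, b) | q <- iota 0 m, b <- [:: false; true]].

Lemma mem_edge_index q b : ((q, b) \in edge_index) = (q < m)%N.
Proof.
apply/allpairsP/idP => [[[q' b'] /= [Hq _ [-> _]]]|lt_qm].
  by rewrite mem_iota in Hq.
by exists (q, b); split; rewrite /= ?mem_iota ?inE //; case: b.
Qed.

(** This law for all [j < e] and [origin_law e] together say that at a start
    the first mark is at distance exactly [e]. *)
Definition input_law (j : nat) : law :=
  (fun y => start y && y tape0 (- j%:Z), None).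
Definition origin_law (e : nat) : law :=
  (fun y => start y && ~~ y tape0 (- e%:Z), None).

Lemma state_le y : (state y <= m)%N.
Proof. by rewrite -(size_iota 0 m) find_size. Qed.

Lemma eq_state y y' :
    (forall i : nat, (i < m)%N -> y tape2 (i.+2)%:Z = y' tape2 (i.+2)%:Z) ->
  state y = state y'.
Proof.
move=> E; apply: eq_in_find => i; rewrite mem_iota => /andP[_ lt_im].
exact: E.
Qed.

Lemma back_view y h h' : h' tape2 = h tape2 - width%:Z ->
  state (back (view y h)) = state (view y h') /\
  branch_bit (back (view y h)) = branch_bit (view y h').
Proof.
move=> E; split; last by rewrite /branch_bit /back /view eqxx E; congr y; lia.
by apply: eq_state => i _; rewrite /back /view eqxx E; congr y; lia.
Qed.

Section Soundness.
Variables (e : nat) (y : tape) (f : pos -> int) (B : nat).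
Hypothesis bounded : forall h, f h != 0 -> (`|h tape2| <= B)%N.
Hypothesis no_defect : obeys defect_law y f.
Hypothesis edges : forall q b, (q < m)%N -> obeys (edge_law (q, b)) y f.
Hypothesis input : forall j, (j < e)%N -> obeys (input_law j) y f.
Hypothesis origin : obeys (origin_law e) y f.

Lemma nodefect h : f h != 0 -> op_ok (view y h) /\ link_ok (view y h).
Proof.
move=> fh; apply/andP; apply: contraNT fh => /negP d.
by apply/eqP/(no_defect (h := h)); rewrite /= /defect; apply/negP.
Qed.

Lemma edge_step h : (state (view y h) < m)%N ->
  f (h + displacement (state (view y h)) (branch_bit (view y h))) = f h.
Proof. by move=> lt_qm; symmetry; apply: (edges lt_qm); rewrite /= !eqxx. Qed.

(** Going back entry by entry keeps the value of [f] and moves the third head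
    to the left; the support of [f] is bounded. *)
Lemma find_start h : f h != 0 -> exists2 h0, f h0 != 0 & start (view y h0).
Proof.
have [n] := ubnP (absz (h tape2 + B%:Z)).
elim: n h => // n IHn h le_n fh.
have [s|ns] := boolP (start (view y h)); first by exists h.
have [_] := nodefect fh; rewrite /link_ok (negPf ns) => /andP[lt_q /eqP st].
set q := state (back _) in lt_q st; set b := branch_bit (back _) in st.
have E2 : (h - displacement q b) tape2 = h tape2 - width%:Z by rewrite !ffunE.
have [Eq Eb] := back_view y E2; rewrite -/q in Eq; rewrite -/b in Eb.
have Ef : f (h - displacement q b) = f h.
  by rewrite -edge_step -Eq -?Eb // subrK.
have fh' : f (h - displacement q b) != 0 by rewrite Ef.
apply: (IHn _ _ fh').
have := bounded fh'; have := bounded fh; rewrite E2 /width.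
move: le_n; rewrite /width; lia.
Qed.

Definition reads h c v :=
  (forall j : nat, (j < v)%N -> ~~ y (ctape c) (h (ctape c) - j%:Z)) /\
  y (ctape c) (h (ctape c) - v%:Z).

Lemma ctape_neq2 c : (ctape c == tape2) = false.
Proof. by case: c. Qed.

Lemma ctape_inj c c' : (ctape c == ctape c') = (c == c').
Proof. by case: c; case: c'. Qed.

Lemma reads_test h c v k : reads h c v ->
  all (fun j : nat => ~~ view y h (ctape c) (- j%:Z)) (iota 0 k) = (k <= v)%N.
Proof.
move=> [r1 r2]; apply/allP/idP => [H|le_kv j].
  rewrite leqNgt; apply/negP => lt_vk.
  by have := H v; rewrite mem_iota lt_vk /view r2 => /(_ isT).
by rewrite mem_iota => /andP[_ lt_jk]; apply: r1; apply: leq_trans le_kv.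
Qed.

(** Going forward from a start, the positions represent the configurations of
    the run as long as the machine has not accepted. *)
Lemma follow h0 n : f h0 != 0 -> start (view y h0) ->
  (forall i, (i < n)%N -> (run P e i).1 <> m) ->
  exists h, [/\ f h != 0, h tape2 = h0 tape2 + (n * width)%:Z,
    state (view y h) = (run P e n).1 &
    forall c, reads h c (counter (run P e n).2 c)].
Proof.
move=> fh0 s0; elim: n => [|n IHn] nacc.
  exists h0; rewrite mul0n addr0; have [_] := nodefect fh0.
  rewrite /link_ok s0 => /and3P[_ /eqP st z1]; split=> // -[] /=.
    by split=> //; rewrite subr0; move: z1; rewrite /view addr0.
  split=> [j lt_je|].
    by apply: contra fh0 => yj; apply/eqP/(input lt_je); rewrite /= s0.
  apply: contraNT fh0 => yj; apply/eqP/(@origin h0); rewrite /= s0.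
  by rewrite /view.
have [|h [fh E2 st rd]] := IHn; first by move=> i lt_in; apply/nacc/ltnW.
have lt_q : (state (view y h) < m)%N.
  by rewrite ltn_neqAle state_le andbT st; apply/eqP/nacc.
have fh' : f (h + displacement (state (view y h)) (branch_bit (view y h))) != 0.
  by rewrite edge_step.
exists (h + displacement (state (view y h)) (branch_bit (view y h))).
set h' := h + _ in fh' *.
have E2' : h tape2 = h' tape2 - width%:Z by rewrite !ffunE /= addrK.
have [Eq Eb] := back_view y E2'.
have [_] := nodefect fh'; rewrite /link_ok Eq Eb.
case: ifP => [_ /andP[/eqP E _]|_ /andP[_ /eqP st']].
  by rewrite E ltnn in lt_q.
have Ew : h' tape2 = h0 tape2 + (n.+1 * width)%:Z.
  by rewrite /h' ffunE E2 ffunE eqxx; lia.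
have Eh c : h' (ctape c) = h (ctape c) + match fetch P (state (view y h)) with
    | IncBy c' d _ => if c == c' then d%:Z else 0
    | DecBy c' d _ _ =>
        if branch_bit (view y h) && (c == c') then - d%:Z else 0
    end.
  rewrite /h' ffunE [in LHS]ffunE ctape_neq2.
  by case: (fetch P _) => *; rewrite ctape_inj.
have [op _] := nodefect fh; rewrite /op_ok lt_q in op.
clearbody h'; rewrite /run iterS -/(run P e n) /step st' /next_state.
clear st' Eq Eb E2' E2.
case: (run P e n) st rd => q v /= st rd.
rewrite st in op lt_q Eh *; rewrite lt_q.
case: (fetch P q) op Eh => [c d q'|c d q1 q2] op Eh.
  split=> // c'; rewrite /reads Eh.
  case: (eqVneq c' c) => [->|ne]; last first.
    rewrite addr0; suff -> : counter (set_counter v c (counter v c + d)) c' =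
       counter v c' by apply: rd.
    by case: (c) (c') ne => -[].
  have [rd1 rd2] := rd c.
  have -> : counter (set_counter v c (counter v c + d)) c = (counter v c + d)%N.
    by case: (c).
  split=> [j lt_j|]; last first.
    by rewrite (_ : _ - _ = h (ctape c) - (counter v c)%:Z) //; lia.
  have [lt_jd|le_dj] := ltnP j d.
    have /allP/(_ (d - j)%N) := op; rewrite mem_iota /view.
    rewrite (_ : _ + d%:Z - j%:Z = h (ctape c) + (d - j)%N%:Z); last lia.
    by apply; lia.
  rewrite (_ : _ + d%:Z - j%:Z = h (ctape c) - (j - d)%N%:Z); last lia.
  by apply: rd1; lia.
rewrite (reads_test _ (rd c)) in op; rewrite (eqP op) in Eh *.
case: leqP => [le_dv|lt_vd].
  split=> // c'; rewrite /reads Eh le_dv /=.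
  case: (eqVneq c' c) => [->|ne]; last first.
    rewrite addr0; suff -> : counter (set_counter v c (counter v c - d)) c' =
       counter v c' by apply: rd.
    by case: (c) (c') ne => -[].
  have [rd1 rd2] := rd c.
  have -> : counter (set_counter v c (counter v c - d)) c = (counter v c - d)%N.
    by case: (c).
  split=> [j lt_j|]; last first.
    by rewrite (_ : _ - _ - _ = h (ctape c) - (counter v c)%:Z) //; lia.
  rewrite (_ : _ - d%:Z - j%:Z = h (ctape c) - (d + j)%N%:Z); last lia.
  by apply: rd1; lia.
split=> // c'; rewrite /reads Eh leqNgt lt_vd /= addr0; exact: rd.
Qed.

(** Within the support there is no room for a run that does not accept. *)
Lemma certificate_sound h : f h != 0 -> accepts P e.
Proof.
move=> /find_start[h0 fh0 s0].
(* In [N] steps the third head moves further than the width of the support. *)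
pose N := (B + B).+1.
have [/existsP[i /eqP acc]|nacc] := boolP [exists i : 'I_N, (run P e i).1 == m].
  by exists i.
have [|h1 [fh1 E _ _]] := @follow h0 N fh0 s0.
  move=> i lt_iN; apply/eqP; move: nacc; rewrite negb_exists => /forallP.
  by move=> /(_ (Ordinal lt_iN)).
have := bounded fh0; have := bounded fh1; rewrite E.
have : (N <= N * width)%N by rewrite leq_pmulr.
rewrite /N; lia.
Qed.

End Soundness.

Section Completeness.
Variables (e n : nat).
Hypothesis halted : (run P e n).1 = m.
Hypothesis running : forall t, (t < n)%N -> ((run P e t).1 < m)%N.

Definition taken t : bool :=
  let s := run P e t in
  match fetch P s.1 with
  | IncBy _ _ _ => false
  | DecBy c k _ _ => (k <= counter s.2 c)%N
  end.

Definition cell_bit t i : bool :=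
  match i with 0 => t == 0%N | 1 => taken t | i'.+2 => i' == (run P e t).1 end.

Definition certificate : tape := fun k j =>
  if k == tape2 then
    if j is Posz p then
      (p %/ width <= n)%N && cell_bit (p %/ width)%N (p %% width)%N
    else false
  else j == 0.

Definition head_pos t : pos := [ffun k =>
  if k == tape2 then (t * width)%:Z
  else if k == tape0 then (run P e t).2.1%:Z
  else if k == tape1 then (run P e t).2.2%:Z else 0].

Definition trajectory : seq pos := [seq head_pos t | t <- iota 0 n.+1].

Lemma certificate_cell t i : (i < width)%N -> (t <= n)%N ->
  certificate tape2 ((t * width)%:Z + i%:Z) = cell_bit t i.
Proof.
move=> lt_i le_tn; rewrite /certificate eqxx -PoszD.
by rewrite divnMDl // divn_small // addn0 modnMDl modn_small // le_tn.
Qed.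

Lemma view_cell h t : h tape2 = (t * width)%:Z -> (t <= n)%N ->
  [/\ state (view certificate h) = (run P e t).1,
      branch_bit (view certificate h) = taken t &
      start (view certificate h) = (t == 0%N)].
Proof.
move=> E le_tn; rewrite /branch_bit /start /view E.
rewrite (certificate_cell (i := 1)) // (certificate_cell (i := 0)) //.
split=> //.
rewrite /state /view E.
rewrite (eq_in_find (a2 := pred1 (run P e t).1)) => [|i]; last first.
  by rewrite mem_iota => lt_i; rewrite certificate_cell.
have le_m : ((run P e t).1 <= m)%N.
  move: le_tn; rewrite leq_eqVlt => /orP[/eqP->|/running/ltnW//].
  by rewrite halted.
rewrite -[find _ _]/(index _ _).
move: le_m; rewrite leq_eqVlt => /orP[/eqP->|lt_m].
  by rewrite memNindex ?size_iota // mem_iota ltnn andbF.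
by rewrite -[X in index X](nth_iota 0 0 lt_m) index_uniq ?size_iota ?iota_uniq.
Qed.

Lemma view_before h : h tape2 = - width%:Z -> state (view certificate h) = m.
Proof.
move=> E; rewrite /state -[RHS](size_iota 0 m); apply: hasNfind.
apply/hasPn => i; rewrite mem_iota => /andP[_ lt_i].
rewrite /view E /certificate eqxx.
case Ej : (- _ + _) => [p|p] //; exfalso.
move: Ej lt_i; rewrite /width -/m; lia.
Qed.

Lemma head_pos_tape2 t : head_pos t tape2 = (t * width)%:Z.
Proof. by rewrite ffunE. Qed.

Lemma head_posS t : (t < n)%N ->
  head_pos t + displacement (run P e t).1 (taken t) = head_pos t.+1.
Proof.
move=> /running lt_q; apply/ffunP => k; move: lt_q.
rewrite !ffunE /run iterS -/(run P e t) /taken.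
case: (run P e t) => q v /= lt_q; rewrite /step lt_q.
case: (eqVneq k tape2) => [_|k2]; first by rewrite mulSn addnC PoszD.
case: (fetch P q) => [c d q'|c d q1 q2]; last case: leqP => le_d.
all: case: (eqVneq k tape0) => [->|k0]; last case: (eqVneq k tape1) => [->|k1].
all: destruct c => //=; try (simpl in *; lia).
all: by rewrite /= ?(negPf k0) ?(negPf k1).
Qed.

Lemma trajectoryP h :
  reflect (exists2 t, (t <= n)%N & h = head_pos t) (h \in trajectory).
Proof.
apply: (iffP mapP) => -[t]; first by rewrite mem_iota => lt_t ->; exists t.
by move=> le_tn ->; exists t; rewrite ?mem_iota.
Qed.

Lemma trajectory_uniq : uniq trajectory.
Proof.
rewrite map_inj_uniq ?iota_uniq // => t t' /ffunP/(_ tape2).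
by rewrite !head_pos_tape2 => -[/eqP]; rewrite eqn_pmul2r // => /eqP.
Qed.

(** For the backward direction, the entry on the left of an entry of the run is
    again one, except at time zero, where it is blank and thus accepting. *)
Lemma mem_trajectory_displacement h q b : (q < m)%N ->
    state (view certificate h) = q -> branch_bit (view certificate h) = b ->
  (h \in trajectory) = (h + displacement q b \in trajectory).
Proof.
move=> lt_q st br; apply/trajectoryP/trajectoryP => -[t le_tn E].
  have [st' br' _] := view_cell (head_pos_tape2 t) le_tn.
  have lt_tn : (t < n)%N.
    rewrite ltn_neqAle le_tn andbT; apply/eqP => Etn.
    by move: lt_q; rewrite -st E st' Etn halted ltnn.
  by exists t.+1 => //; rewrite -head_posS // E -st -br E st' br'.
have E2 : h tape2 = (t * width)%:Z - width%:Z.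
  by rewrite -head_pos_tape2 -E !ffunE /= addrK.
case: t le_tn E E2 => [|t] le_tn E E2.
  by move: lt_q; rewrite -st view_before ?ltnn // E2 sub0r.
have Eh : h tape2 = (t * width)%:Z by rewrite E2; lia.
have [st' br' _] := view_cell Eh (ltnW le_tn).
exists t; first exact: ltnW.
by apply: (addIr (displacement q b)); rewrite E -head_posS // -st -br st' br'.
Qed.

Lemma counter_read t c j :
  view certificate (head_pos t) (ctape c) j =
    ((counter (run P e t).2 c)%:Z + j == 0).
Proof. by rewrite /view /certificate ctape_neq2 ffunE ctape_neq2; case: c. Qed.

Lemma trajectory_op_ok t : (t <= n)%N -> op_ok (view certificate (head_pos t)).
Proof.
move=> le_tn; have [st br _] := view_cell (head_pos_tape2 t) le_tn.
rewrite /op_ok st br /taken; case: ifP => // _.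
case: (fetch P _) => [c k q'|c k q1 q2].
  by apply/allP => j; rewrite mem_iota counter_read; lia.
apply/eqP; symmetry; apply/allP/idP => [H|le_kv j].
  rewrite leqNgt; apply/negP => lt_vk.
  have := H (counter (run P e t).2 c).
  by rewrite mem_iota lt_vk counter_read subrr => /(_ isT).
by rewrite mem_iota counter_read; lia.
Qed.

Lemma run_next t : (t < n)%N ->
  (run P e t.+1).1 = next_state (run P e t).1 (taken t).
Proof.
move=> /running; rewrite /run iterS -/(run P e t) /next_state /taken.
case: (run P e t) => q v /= lt_q; rewrite /step lt_q.
by case: (fetch P q) => // c k q1 q2; case: leqP.
Qed.

Lemma trajectory_link_ok t :
  (t <= n)%N -> link_ok (view certificate (head_pos t)).
Proof.
move=> le_tn; have [st br s] := view_cell (head_pos_tape2 t) le_tn.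
rewrite /link_ok s st.
case: t le_tn st br s => [|t] le_tn st br s /=.
  have [|-> _] :=
      @back_view certificate (head_pos 0) (head_pos 0 - [ffun=> width%:Z]).
    by rewrite !ffunE.
  rewrite view_before ?eqxx; last by rewrite !ffunE.
  by have /= -> := counter_read 0 true 0.
have [|-> ->] := @back_view certificate (head_pos t.+1) (head_pos t).
  by rewrite !head_pos_tape2; lia.
have [-> -> _] := view_cell (head_pos_tape2 t) (ltnW le_tn).
by rewrite running // run_next // eqxx.
Qed.

End Completeness.

Definition closed_law (l : law) y (C : seq pos) :=
  forall h, l.1 (view y h) ->
    (h \in C) = if l.2 is Some p then h + p \in C else false.

(** The first accepting time is used: before it no state is accepting, and so
    the certificate does not break off. *)
Lemma certificate_complete e : accepts P e ->
  exists y, exists2 C : seq pos, uniq C && (C != [::]) &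
    [/\ closed_law defect_law y C,
        forall q b, (q < m)%N -> closed_law (edge_law (q, b)) y C,
        forall j, (j < e)%N -> closed_law (input_law j) y C &
        closed_law (origin_law e) y C].
Proof.
move=> acc.
have {acc} acc : exists n, (run P e n).1 == m by case: acc => n /eqP; exists n.
case: (ex_minnP acc) => n /eqP halted minn.
(* From state [m] on nothing moves: the run would have accepted at time [t]. *)
have running t : (t < n)%N -> ((run P e t).1 < m)%N.
  move=> lt_tn; rewrite ltnNge; apply/negP => ge_m.
  have stuck i : run P e (i + t) = run P e t.
    elim: i => // i; rewrite addSn /run iterS -!/(run P e _) => ->.
    by case: (run P e t) ge_m => q v /=; rewrite ltnNge => ->.
  have Et : run P e n = run P e t by rewrite -(subnK (ltnW lt_tn)) stuck.
  by have := minn t; rewrite -Et halted eqxx leqNgt lt_tn => /(_ isT).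
exists (certificate e n), (trajectory e n).
  by rewrite trajectory_uniq //= -size_eq0 size_map size_iota.
split=> [h|q b lt_q h|j lt_je h|h] /=.
- rewrite /defect => d; apply/negbTE.
  apply: contra d => /trajectoryP[t le_tn ->].
  by rewrite trajectory_op_ok // trajectory_link_ok.
- by move=> /andP[/eqP st /eqP br]; apply: mem_trajectory_displacement.
- move=> /andP[s yj]; apply/negbTE; apply/negP => /trajectoryP[t le_tn Eh].
  move: s yj; rewrite Eh.
  have [_ _ ->] := view_cell halted running (head_pos_tape2 e t) le_tn.
  move=> /eqP->; rewrite (counter_read e n 0 false) /=; lia.
- move=> /andP[s yj]; apply/negbTE; apply/negP => /trajectoryP[t le_tn Eh].
  move: s yj; rewrite Eh.
  have [_ _ ->] := view_cell halted running (head_pos_tape2 e t) le_tn.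
  by move=> /eqP->; rewrite (counter_read e n 0 false) /= subrr.
Qed.

End Certificate.

(** * The group ring element of a machine *)

Lemma lamp_sqr k j : (lamp_at k j * lamp_at k j)%g = 1%g.
Proof.
apply/ffunP => i; rewrite !ffunE; case: eqP => _; last exact: mulg1.
congr (_, _); rewrite /= shift0; apply/malgP => l.
rewrite mcoeffD mcoeffU mcoeff0; case: (j == l); last exact: addr0.
exact: val_inj.
Qed.

Lemma lamplighterM (x x' : lamplighter) :
  (x * x')%g = (x.1 + shift x.2 x'.1, x.2 + x'.2) :> lamplighter.
Proof. by []. Qed.

Lemma lamp_comm k j k' j' : commute (lamp_at k j) (lamp_at k' j').
Proof.
rewrite /commute; apply/ffunP => i; rewrite !ffunE.
case: (i == k); case: (i == k').
- by rewrite !lamplighterM /= !shift0 [X in (X, _) = _]addrC.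
- by rewrite mul1g; apply: mulg1.
- by rewrite mul1g; symmetry; apply: mulg1.
- by [].
Qed.



(** Reads the start bit and one cell of the first tape. These are the only
    elements that depend on the input, and [corner] keeps them explicit enough
    for their codes to be computed. *)
Definition probe_elt c j : ZL4 :=
  corner c (lamp_at tape2 0) (lamp_at tape0 (- j%:Z)).

Lemma fourier_probe c j (y : tape) (h : pos) S :
  fourier y h (probe_elt c j * S) =
    (1 - (-1) ^+ y tape2 (h tape2)) *
    (1 - c * (-1) ^+ y tape0 (h tape0 - j%:Z)) * fourier y h S.
Proof.
have E T : fourier y h (T - mono c (lamp_at tape0 (- j%:Z)) * T) =
    (1 - c * (-1) ^+ y tape0 (h tape0 - j%:Z)) * fourier y h T.
  by rewrite mulrBl mul1r fourierB; congr (_ - _); apply: fourier_lamp.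
rewrite cornerM; move: (E S); move: (S - _) => T ET; rewrite -mulrA -ET.
rewrite mulrBl mul1r fourierB; congr (_ - _).
by etransitivity; [apply: fourier_lamp | rewrite mul1r addr0].
Qed.

Lemma enforces_input j : enforces [:: probe_elt 1 j] (obeys (input_law j)).
Proof.
apply: (enforces_law (a := 4)) => // y h S.
rewrite fourier_probe subr0 /= /start /view addr0.
by case: (y tape2 _); case: (y tape0 _) => /=; ring.
Qed.

Lemma enforces_origin e : enforces [:: probe_elt (-1) e] (obeys (origin_law e)).
Proof.
apply: (enforces_law (a := 4)) => // y h S.
rewrite fourier_probe subr0 /= /start /view addr0.
by case: (y tape2 _); case: (y tape0 _) => /=; ring.
Qed.

Section MachineElement.
Variable P : program.

Definition instr_radius i :=
  match i with IncBy _ k _ => k | DecBy _ k _ _ => k end.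

Definition radius : nat :=
  width P + \max_(q < size P) instr_radius (fetch P q).

Lemma instr_radius_le q :
  (q < size P)%N -> (instr_radius (fetch P q) <= radius)%N.
Proof.
move=> lt_q; apply: leq_trans (leq_addl _ _).
exact: (leq_bigmax (Ordinal lt_q)).
Qed.

Lemma depends_sub D D' c :
  {subset D <= D'} -> depends_on D c -> depends_on D' c.
Proof. by move=> sub loc y y' E; apply: loc => d /sub/E. Qed.

Lemma ball_sub r r' : (r <= r')%N -> {subset ball r <= ball r'}.
Proof. by move=> le_r [k j]; rewrite !mem_ball => /leq_trans->. Qed.

Lemma width_le_radius : (width P <= radius)%N.
Proof. exact: leq_addr. Qed.

Lemma state_depends y y' :
    (forall d, d \in ball radius -> y d.1 d.2 = y' d.1 d.2) ->
  [/\ state P y = state P y', branch_bit y = branch_bit y', start y = start y',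
      state P (back P y) = state P (back P y') &
      branch_bit (back P y) = branch_bit (back P y')].
Proof.
move=> H; have E k j : (`|j| <= width P)%N -> y k j = y' k j.
  move=> le_j; apply: (H (k, j)).
  by rewrite mem_ball (leq_trans le_j) // width_le_radius.
rewrite /branch_bit /start; split; try by apply: E.
- by apply: eq_state => i lt_i; apply: E; rewrite /width; lia.
- apply: eq_state => i lt_i; rewrite /back eqxx; apply: E.
  by rewrite /width; lia.
- by rewrite /back eqxx; apply: E; rewrite /width; lia.
Qed.

Lemma defect_depends : depends_on (ball radius) (defect P).
Proof.
move=> y y' H; have [E1 E2 E3 E4 E5] := state_depends H.
rewrite /defect /op_ok /link_ok E1 E2 E3 E4 E5.
have -> : y tape1 0 = y' tape1 0 by apply: (H (tape1, 0)); rewrite mem_ball.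
congr (~~ (_ && _)); case: ifP => // /instr_radius_le.
case: (fetch P _) => [c k q|c k q q'] /= le_k.
  apply: eq_in_all => j; rewrite mem_iota => lt_j; congr negb.
  by apply: (H (ctape c, j%:Z)); rewrite mem_ball; lia.
congr (_ == _); apply: eq_in_all => j; rewrite mem_iota => lt_j; congr negb.
by apply: (H (ctape c, - j%:Z)); rewrite mem_ball; lia.
Qed.

Lemma edge_depends qb : depends_on (ball radius) (edge_law P qb).1.
Proof. by move=> y y' /state_depends[E1 E2 _ _ _] /=; rewrite E1 E2. Qed.

Lemma input_depends j : depends_on (ball j) (input_law j).1.
Proof.
move=> y y' H /=; rewrite /start; congr (_ && _).
  by apply: (H (tape2, 0)); rewrite mem_ball.
by apply: (H (tape0, - j%:Z)); rewrite mem_ball; lia.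
Qed.

Lemma origin_depends j : depends_on (ball j) (origin_law j).1.
Proof.
move=> y y' H /=; rewrite /start; congr (_ && ~~ _).
  by apply: (H (tape2, 0)); rewrite mem_ball.
by apply: (H (tape0, - j%:Z)); rewrite mem_ball; lia.
Qed.

Definition machine_elts : seq ZL4 :=
  law_elt (ball radius) (defect_law P) ::
  [seq law_elt (ball radius) (edge_law P qb) | qb <- edge_index P].

(** In the order in which primitive recursion on [e] adds them in front of a
    list. *)
Definition input_elts e : seq ZL4 :=
  probe_elt (-1) e :: [seq probe_elt 1 j | j <- rev (iota 0 e)].

Definition machine_laws e y f :=
  (obeys (origin_law e) y f /\
   (forall j, j \in rev (iota 0 e) -> obeys (input_law j) y f)) /\
  (obeys (defect_law P) y f /\
   (forall qb, qb \in edge_index P -> obeys (edge_law P qb) y f)).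

Lemma enforces_machine_laws e :
  enforces (input_elts e ++ machine_elts) (machine_laws e).
Proof.
apply: enforces_cat.
  apply: (enforces_cat (us := [:: _])); first exact: enforces_origin.
  by apply: enforces_map => j _; apply: enforces_input.
apply: (enforces_cat (us := [:: _])).
  by apply: enforces_law_elt; apply: defect_depends.
by apply: enforces_map => qb _; apply: enforces_law_elt; apply: edge_depends.
Qed.

(** The support of [fourier y h S] lies in the positions of the support of [S],
    which bounds it for [certificate_sound]. *)
Theorem zero_divisor_accepts e :
  zero_divisor (sum_squares (input_elts e ++ machine_elts)) <-> accepts P e.
Proof.
rewrite zero_divisor_sum_squares; split=> [[S S0 ann]|acc].
  have laws := proj1 (enforces_machine_laws e S) ann.
  have [y [h nz]] := fourier_neq0 S0.
  have [[orig inp] [def edg]] := laws y.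
  apply: (@certificate_sound P e y (fourier y ^~ S)
    (\max_(g <- msupp S) `|(pos_of g : pos) tape2|%N) _ def _ _ orig h nz).
  - move=> h' nz'; have /mapP[g gS ->] := fourier_supp nz'.
    exact: (leq_bigmax_seq
      (F := fun g : L4 => `|(pos_of g : pos) tape2|%N) g gS isT).
  - by move=> q b lt_q; apply: edg; rewrite mem_edge_index.
  - by move=> j lt_j; apply: inp; rewrite mem_rev mem_iota.
have [y [C /andP[uC C0] [def edg inp orig]]] := certificate_complete acc.
have [S S0 H] := exists_annihilated y
  [seq displacement P qb.1 qb.2 | qb <- edge_index P] (radius + e) uC C0.
exists S => //; apply/(enforces_machine_laws e S) => y'; split; split.
- apply: H => //; apply: depends_sub (@origin_depends e).
  exact/ball_sub/leq_addl.
- move=> j; rewrite mem_rev mem_iota => lt_j; apply: H => //.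
    apply: depends_sub (@input_depends j).
    by apply/ball_sub/(leq_trans _ (leq_addl _ _))/ltnW.
  exact: inp.
- apply: H => //; apply: depends_sub defect_depends.
  exact/ball_sub/leq_addr.
- move=> [q b] qb; apply: H.
  + by apply: depends_sub (@edge_depends _); apply/ball_sub/leq_addr.
  + exact: (map_f (fun qb => displacement P qb.1 qb.2) qb).
  + by apply: edg; rewrite mem_edge_index in qb.
Qed.
End MachineElement.

(** * Codes of formal sums and the diagonal argument *)

Section FormalSums.
Variables (G : groupType) (n : nat) (gen : 'I_n -> G).
Implicit Types (w : word n) (s : formal_sum n).

Lemma word_value_cat w1 w2 :
  word_value gen (w1 ++ w2) = (word_value gen w1 * word_value gen w2)%g.
Proof. exact: big_cat. Qed.

Lemma word_value_pow w j :
  word_value gen (flatten (nseq j w)) = (word_value gen w ^+ j)%g.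
Proof.
elim: j => [|j IHj] /=; first exact: big_nil.
by rewrite word_value_cat IHj expgS.
Qed.

Lemma sum_value_cat s1 s2 :
  sum_value gen (s1 ++ s2) = sum_value gen s1 + sum_value gen s2.
Proof. exact: big_cat. Qed.

Lemma sum_value_nil : sum_value gen [::] = 0.
Proof. exact: big_nil. Qed.

Lemma sum_value_cons c w s :
  sum_value gen ((c, w) :: s) = mono c (word_value gen w) + sum_value gen s.
Proof. by rewrite monoE; apply: big_cons. Qed.

Lemma sum_value_surj (T : groupring int G) : generates gen ->
  exists s, sum_value gen s = T.
Proof.
move=> gens; elim/groupring_ind: T => [|T1 T2 [s1 <-] [s2 <-]|c x].
- by exists [::]; apply: sum_value_nil.
- by exists (s1 ++ s2); apply: sum_value_cat.
- have [w <-] := gens x; exists [:: (c, w)].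
  by rewrite sum_value_cons sum_value_nil addr0.
Qed.
End FormalSums.

Lemma code_sum_cat n (s1 s2 : formal_sum n) :
  code_sum (s1 ++ s2) =
  foldr push (code_sum s2)
    [seq push (code_int t.1) (push (code_word t.2) 0) | t <- s1].
Proof. by rewrite /code_sum map_cat code_push foldr_cat. Qed.

Section Reduction.
Variables (n : nat) (wb wa ws wsi : word n).

(** Walks [j] cells to the left, switches the lamp and walks back. *)
Definition probe_word j : word n :=
  flatten (nseq j wsi) ++ wa ++ flatten (nseq j ws).

(** The expansion of [star u * u] for [u] the [probe_elt] of [c] and [j]. *)
Definition probe_sum (c : int) j : formal_sum n :=
  [:: (4, [::]); (- 4, wb); (- (4 * c), probe_word j);
      (4 * c, wb ++ probe_word j)].

Definition input_sum e : formal_sum n :=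
  probe_sum (-1) e ++ flatten [seq probe_sum 1 j | j <- rev (iota 0 e)].

Definition code_letters (w : word n) := [seq code_letter l | l <- w].

Lemma code_word_cat (w1 w2 : word n) :
  code_word (w1 ++ w2) = foldr push (code_word w2) (code_letters w1).
Proof. by rewrite /code_word map_cat code_push foldr_cat. Qed.

Definition push_word w z := foldr push z (code_letters w).

Lemma code_word_pow w j w' :
  code_word (flatten (nseq j w) ++ w') = iter j (push_word w) (code_word w').
Proof. by elim: j => //= j IHj; rewrite -catA code_word_cat IHj. Qed.

Definition probe_code j : nat :=
  iter j (push_word wsi) (push_word wa (iter j (push_word ws) 0%N)).

Lemma probe_codeE j : code_word (probe_word j) = probe_code j.
Proof.
rewrite /probe_word code_word_pow code_word_cat.
by rewrite -[flatten (nseq j ws)]cats0 code_word_pow.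
Qed.

Definition push_probe (c : int) j z : nat :=
  push (push (code_int 4) (push (code_word ([::] : word n)) 0))
  (push (push (code_int (- 4)) (push (code_word wb) 0))
  (push (push (code_int (- (4 * c))) (push (probe_code j) 0))
  (push (push (code_int (4 * c)) (push (push_word wb (probe_code j)) 0)) z))).

Lemma code_probe_sum c j s :
  code_sum (probe_sum c j ++ s) = push_probe c j (code_sum s).
Proof.
rewrite code_sum_cat /probe_sum /push_probe -probe_codeE /push_word.
by rewrite -code_word_cat.
Qed.

(** From the code [x] of a formal sum to the code of the same sum with the
    terms for the input [2 ^ x] in front. *)
Definition reduction (x : nat) : nat :=
  push_probe (-1) (2 ^ x) (nat_rec (fun _ => nat) x (push_probe 1) (2 ^ x)).

Lemma code_reduction (s : formal_sum n) (x := code_sum s) :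
  code_sum (input_sum (2 ^ x) ++ s) = reduction x.
Proof.
rewrite /input_sum -catA code_probe_sum /reduction; congr push_probe.
elim: (2 ^ x)%N => // m IHm.
have -> : rev (iota 0 m.+1) = m :: rev (iota 0 m).
  by rewrite -{1}addn1 iotaD rev_cat.
rewrite map_cons -[flatten _]/(probe_sum 1 m ++ flatten _) -catA.
by rewrite code_probe_sum IHm.
Qed.

Lemma computable_iter_push k (F N : k.-tuple nat -> nat) w :
  computable F -> computable N ->
  computable (fun v => iter (N v) (push_word w) (F v)).
Proof. by apply: computable_iter => k' F'; apply: computable_pushes. Qed.

Lemma computable_push_probe c k (F Z : k.-tuple nat -> nat) :
  computable F -> computable Z ->
  computable (fun v => push_probe c (F v) (Z v)).
Proof.
move=> cF cZ; have c0 a := computable_const k a.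
have cV : computable (fun v => probe_code (F v)).
  apply: (computable_iter_push _ _ cF); apply: computable_pushes.
  exact: computable_iter_push (c0 0%N) cF.
do 2!(apply: computable_push; first exact: c0).
apply: computable_push.
  by apply: computable_push; [apply: c0 | apply: computable_push].
apply: computable_push cZ.
apply: computable_push; first exact: c0.
by apply: computable_push => //; apply: computable_pushes.
Qed.

Lemma computable_reduction :
  computable (fun v : 1.-tuple nat => reduction (thead v)).
Proof.
have cx := computable_proj (ord0 : 'I_1).
apply: computable_push_probe; first exact: computable_exp2.
have cm := computable_proj (ord0 : 'I_3).
have cz := computable_proj (lift ord0 ord0 : 'I_3).
exact: computable_rec cx (computable_push_probe 1 cm cz) (computable_exp2 cx).
Qed.
End Reduction.

Definition unit_shift (c : int) : pos :=
  [ffun k => if k == tape0 then c else 0].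

Lemma translation_pow c j :
  (translation (unit_shift c) ^+ j)%g = translation (unit_shift (c * j%:Z)).
Proof.
elim: j => [|j IHj].
  rewrite mulr0 expg0; apply/ffunP => k.
  by rewrite !ffunE; case: ifP.
rewrite expgS IHj; apply/ffunP => k.
rewrite L4M !ffunE /= shiftn0 addr0; congr (_, _).
by case: ifP => _; rewrite ?addr0 // intS mulrDr mulr1.
Qed.

Lemma lamp_conj j :
  (translation (unit_shift (- j)) *
     (lamp_at tape0 0 * translation (unit_shift j)))%g = lamp_at tape0 (- j).
Proof.
apply/ffunP => k; rewrite !L4M !ffunE /=.
case: ifP => _ /=.
  rewrite !shiftn0 !addr0 !add0r addNr; congr (_, _).
  apply/malgP => i; rewrite shiftE !mcoeffU opprK; congr (_ *+ nat_of_bool _).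
  by rewrite -[RHS](inj_eq (addIr j)) addNr.
by rewrite !shift0 !addr0.
Qed.

Section Values.
Variables (n : nat) (gen : 'I_n -> L4) (wb wa ws wsi : word n).
Hypothesis Hb : word_value gen wb = lamp_at tape2 0.
Hypothesis Ha : word_value gen wa = lamp_at tape0 0.
Hypothesis Hs : word_value gen ws = translation (unit_shift 1).
Hypothesis Hsi : word_value gen wsi = translation (unit_shift (-1)).

Lemma probe_word_value j :
  word_value gen (probe_word wa ws wsi j) = lamp_at tape0 (- j%:Z).
Proof.
rewrite !word_value_cat !word_value_pow Ha Hs Hsi !translation_pow mul1r mulN1r.
exact: lamp_conj.
Qed.

Lemma probe_sum_value c j : c * c = 1 ->
  sum_value gen (probe_sum wb wa ws wsi c j) =
    star (probe_elt c j) * probe_elt c j.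
Proof.
move=> c2; rewrite corner_star_square ?lamp_sqr //; last exact: lamp_comm.
rewrite !sum_value_cons sum_value_nil word_value_cat probe_word_value Hb.
by rewrite [word_value gen [::]]big_nil addr0 !addrA.
Qed.

Lemma input_sum_value e :
  sum_value gen (input_sum wb wa ws wsi e) = sum_squares (input_elts e).
Proof.
rewrite sum_value_cat probe_sum_value // /sum_squares big_cons; congr (_ + _).
elim: (rev _) => [|j r IHr]; first by rewrite sum_value_nil big_nil.
by rewrite !map_cons big_cons -IHr -probe_sum_value // -sum_value_cat.
Qed.
End Values.

(** The input [2 ^ x] is the store with [x] in register [0] and zero elsewhere;
    the value [b] appears in register [1]. *)
Lemma accepts_test_machine_decider (d : murec 1) x (b : bool) :
    mueval d [tuple x] b ->
  accepts (test_machine (cmd_of d (fun _ => 0%N) 1 2) (reg_prime 1)) (2 ^ x)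
    <-> ~~ b.
Proof.
move=> ev; pose s r := if r == 0%N then x else 0%N.
have E0 : reg (2 ^ x) =1 s.
  move=> r; rewrite /reg lognX -[X in logn _ X]/(reg_prime 0).
  rewrite (logn_prime _ (reg_prime_prime 0)).
  by rewrite (inj_eq reg_prime_inj) /s; case: eqP; rewrite ?muln1 ?muln0.
have H := cmd_of_correct ev (ins := fun _ => 0%N) (out := 1%N) (fr := 2%N)
  (s := s).
have [//|//|//|i|[|[|r]] //||N' [N'0 ex E]] := H _ _ _ _ _ _ _ E0.
- by rewrite (ord1 i).
- by rewrite expn_gt0.
rewrite (test_machine_accepts ex (bases_gt0_cmd_of _ _ _ _) (reg_prime_gt0 1)).
by rewrite reg_dvd // E /upd /=; case: b {ev H E}.
Qed.

Theorem corollary5 (n : nat) (gen : 'I_n -> {ffun 'I_4 -> lamplighter})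
    (gen_generates : generates gen) :
  ~ algorithmically_decidable (@code_sum n)
      (fun s : formal_sum n => zero_divisor (sum_value gen s)).
Proof.
move=> [c decides].
have [wb Hb] := gen_generates (lamp_at tape2 0).
have [wa Ha] := gen_generates (lamp_at tape0 0).
have [ws Hs] := gen_generates (translation (unit_shift 1)).
have [wsi Hsi] := gen_generates (translation (unit_shift (-1))).
have [r Hr] := computable_reduction wb wa ws wsi.
pose d := MuComp c (fun _ : 'I_1 => r).
pose P := test_machine (cmd_of d (fun _ => 0%N) 1 2) (reg_prime 1).
have [sP HP] := sum_value_surj (sum_squares (machine_elts P)) gen_generates.
(* The machine will meet its own elements, through their code. *)
pose x := code_sum sP.
have [b [ev bP]] := decides (input_sum wb wa ws wsi (2 ^ x) ++ sP).
have evd : mueval d [tuple x] b.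
  exists [tuple code_sum (input_sum wb wa ws wsi (2 ^ x) ++ sP)] => //= i.
  by rewrite (ord1 i) code_reduction; apply: (Hr [tuple x]).
have acc := accepts_test_machine_decider evd.
rewrite -/P -zero_divisor_accepts in acc.
rewrite sum_value_cat HP input_sum_value // /sum_squares -big_cat in bP.
move: acc; rewrite -bP.
by case: (b) => -[H1 H2]; [have := H1 isT | have := H2 isT].
Qed.
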